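(* Let $V$ be a countably infinite set and let $P=\{P(x,y)\}_{x,y\in V}$ be a stochastic, symmetric matrix. Let $\Gamma\le\mathsf{Aut}(P)$ be a closed, amenable, unimodular subgroup which acts transitively on $V$. Suppose there exists a connected graph $G=(V,E)$ on which $\Gamma$ acts by automorphisms, and that for $x\in V$, $$\sum_{y\in V}P(x,y)\,\mathsf{dist}(x,y)^2<\infty,$$ where $\mathsf{dist}$ is the path metric on $G$. Suppose also that $$p_*=\min\{P(x,y):\{x,y\}\in E\}>0.$$ Then there exist a Hilbert space $\mathcal H$ and a nonconstant $\Gamma$-equivariant $P$-harmonic mapping from $V$ into $\mathcal H$.
   Context: $\mathsf{Aut}(P)$ is the group of all bijections $\sigma:V\to V$ with $P(\sigma x,\sigma y)=P(x,y)$ for all $x,y\in V$, equipped with the topology of pointwise convergence on $V$ ($V$ discrete). Unimodular means that the (locally compact) group $\Gamma$ has a Haar measure that is both left- and right-invariant; amenable is meant in the sense of locally compact groups. ''$\Gamma$ acts on $G=(V,E)$ by automorphisms'' means that each $\sigma\in\Gamma$, acting on $V$, preserves $E$. A mapping $\Psi:V\to\mathcal H$ is $P$-harmonic if $\Psi(x)=\sum_{y\in V}P(x,y)\Psi(y)$ for all $x\in V$. It is $\Gamma$-equivariant if there exists an affine isometric action $\pi$ of $\Gamma$ on $\mathcal H$ such that $\pi(g)\Psi(x)=\Psi(gx)$ for all $g\in\Gamma$, $x\in V$. *)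

(* Defs.v *)
From HB Require Import structures.
From mathcomp Require Import all_boot all_order all_algebra finmap.
From mathcomp Require Import all_classical all_reals all_analysis.
From mathcomp.analysis.showcase Require summability.

Set Implicit Arguments.
Unset Strict Implicit.
Unset Printing Implicit Defensive.
Import Order.TTheory GRing.Theory Num.Theory.
Import numFieldNormedType.Exports.
Local Open Scope classical_set_scope.
Local Open Scope ring_scope.

HB.structure Definition PreTopologicalGroup :=
  {G of Group G & Topological G & Pointed G}.

HB.mixin Record PreTopologicalGroup_isTopologicalGroup G
    of PreTopologicalGroup G := {
  mulg_continuous : continuous (fun x : G * G => (x.1 * x.2)%g) ;
  invg_continuous : continuous (fun x : G => x^-1%g)
}.

#[short(type="topologicalGroupType")]
HB.structure Definition TopologicalGroup :=
  {G of PreTopologicalGroup G & PreTopologicalGroup_isTopologicalGroup G}.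

Definition subgroup (G : groupType) (S : groupClosed G) : Type :=
  {x : G | x \in S}.

HB.instance Definition _ (G : groupType) (S : groupClosed G) :=
  SubChoice.copy (subgroup S) {x : G | x \in S}.
Lemma subgroup_group_closed (G : groupType) (S : groupClosed G) :
  group_closed (fun x : G => x \in S).
Proof. by split=> [|x y xS yS]; [exact: gpred1|exact: gpredF]. Qed.
HB.instance Definition _ (G : groupType) (S : groupClosed G) :=
  SubChoice_isSubGroup.Build G (fun x : G => x \in S) (subgroup S)
    (@subgroup_group_closed G S).
HB.instance Definition _ (G : groupType) (S : groupClosed G) :=
  isPointed.Build (subgroup S) 1%g.
HB.instance Definition _ (G : topologicalGroupType) (S : groupClosed G) :=
  Topological.copy (subgroup S) (initial_topology (val : subgroup S -> G)).

Lemma subgroup_mulg_continuous (G : topologicalGroupType) (S : groupClosed G) :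
  continuous (fun x : subgroup S * subgroup S => (x.1 * x.2)%g).
Proof.
apply: continuous_comp_initial => x.
have -> : val \o (fun x : subgroup S * subgroup S => (x.1 * x.2)%g) =
  (fun x => (x.1 * x.2)%g) \o (fun x => (val x.1 : G, val x.2 : G)).
  by apply/funext => y.
apply: continuous_comp; last exact: mulg_continuous.
by apply: cvg_pair => /=; apply: continuous_comp;
  [exact: cvg_fst|exact: initial_continuous|
   exact: cvg_snd|exact: initial_continuous].
Qed.

Lemma subgroup_invg_continuous (G : topologicalGroupType) (S : groupClosed G) :
  continuous (fun x : subgroup S => x^-1%g).
Proof.
apply: continuous_comp_initial => x.
have -> : val \o (fun x : subgroup S => x^-1%g) =
  (fun x : G => x^-1%g) \o val by apply/funext => y.
apply: continuous_comp; first exact: initial_continuous.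
exact: invg_continuous.
Qed.

HB.instance Definition _ (G : topologicalGroupType) (S : groupClosed G) :=
  PreTopologicalGroup_isTopologicalGroup.Build (subgroup S)
    (@subgroup_mulg_continuous G S) (@subgroup_invg_continuous G S).

Section Aut.
Context {R : realType} {V : countType} (P : V -> V -> R).

Definition is_aut : set {ptws V -> discrete_topology V} :=
  [set s | bijective s /\ forall x y, P (s x) (s y) = P x y].

Definition AutP : Type := set_type is_aut.

HB.instance Definition _ := Topological.copy AutP (set_type is_aut).

Definition aut_fun (s : AutP) : V -> V := val s.

Definition mk_aut (f : V -> V) (fP : is_aut f) : AutP :=
  @exist _ (fun s => s \in is_aut) f (mem_set fP).

Lemma aut_inj (s t : AutP) : aut_fun s =1 aut_fun t -> s = t.
Proof. by move=> st; apply/val_inj/funext. Qed.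

Lemma is_aut_id : is_aut id.
Proof. by split=> //; exists id. Qed.

Lemma is_aut_comp (s t : AutP) : is_aut (aut_fun s \o aut_fun t).
Proof.
have [sb sP] := set_mem (valP s); have [tb tP] := set_mem (valP t).
by split=> [|x y]; [exact: bij_comp|rewrite /= sP tP].
Qed.

Lemma aut_inv_ex (s : AutP) :
  {t : V -> V | [/\ is_aut t, cancel (aut_fun s) t & cancel t (aut_fun s)]}.
Proof.
apply: cid; have [[t st ts] sP] := set_mem (valP s); exists t; split=> //.
by split=> [|x y]; [exists (aut_fun s)|rewrite -sP !ts].
Qed.

Definition aut_one : AutP := mk_aut is_aut_id.

Definition aut_mul (s t : AutP) : AutP := mk_aut (is_aut_comp s t).

Definition aut_inv (s : AutP) : AutP :=
  let: And3 h _ _ := svalP (aut_inv_ex s) in mk_aut h.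

Lemma aut_invE s : aut_fun (aut_inv s) = sval (aut_inv_ex s).
Proof. by rewrite /aut_inv; case: (svalP (aut_inv_ex s)). Qed.

Lemma aut_mulA : associative aut_mul. Proof. by move=> s t u; exact: aut_inj. Qed.
Lemma aut_mul1 : left_id aut_one aut_mul. Proof. by move=> s; exact: aut_inj. Qed.
Lemma aut_mulr1 : right_id aut_one aut_mul.
Proof. by move=> s; exact: aut_inj. Qed.
Lemma aut_mulV : left_inverse aut_one aut_inv aut_mul.
Proof.
move=> s; apply: aut_inj => x; change (aut_fun (aut_inv s) (aut_fun s x) = x); rewrite aut_invE.
by case: (svalP (aut_inv_ex s)) => _ + _; apply.
Qed.
Lemma aut_mulrV : right_inverse aut_one aut_inv aut_mul.
Proof.
move=> s; apply: aut_inj => x; change (aut_fun s (aut_fun (aut_inv s) x) = x); rewrite aut_invE.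
by case: (svalP (aut_inv_ex s)) => _ _; apply.
Qed.

HB.instance Definition _ :=
  isGroup.Build AutP aut_mulA aut_mul1 aut_mulr1 aut_mulV aut_mulrV.
HB.instance Definition _ := isPointed.Build AutP aut_one.

Lemma aut_funM (s t : AutP) x : aut_fun (s * t)%g x = aut_fun s (aut_fun t x).
Proof. by []. Qed.

Lemma aut_funK (s : AutP) : cancel (aut_fun s) (aut_fun s^-1%g).
Proof. by move=> x; rewrite -aut_funM mulVg. Qed.

Lemma aut_funVK (s : AutP) : cancel (aut_fun s^-1%g) (aut_fun s).
Proof. by move=> x; rewrite -aut_funM mulgV. Qed.

Lemma cvg_autP (F : set_system AutP) (s : AutP) : Filter F ->
  (F --> s) <-> (forall x, \forall t \near F, aut_fun t x = aut_fun s x).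
Proof.
move=> FF; split=> [Fs x|Fs].
  have : (fun t : AutP => aut_fun t x) @ F --> (aut_fun s x : discrete_topology V).
    apply: (@cvg_comp _ _ _ (fun t : AutP => val t : {ptws V -> discrete_topology V})
      (fun f => f x) F (nbhs (val s))).
      apply: cvg_trans (@initial_continuous AutP _ val s).
      by apply: cvg_app.
    exact: (@proj_continuous V (fun=> discrete_topology V) x).
  by move=> /(_ _ (discrete_set1 (aut_fun s x : discrete_topology V))).
move=> A [_ [[B oB <-] Bs] /filterS]; apply.
have : {ptws, val @ F --> val s}.
  apply/cvg_sup => x; apply/(@cvg_image _ _
    (fun f : {ptws V -> discrete_topology V} => f x)).
    by rewrite eqEsubset; split=> // v _; exists (cst v).
  move=> W; rewrite nbhs_principalE => /principal_filterP Wx.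
  exists [set t | W (t x)]; last first.
    by rewrite eqEsubset; split=> [_ [t + <-]//|v Wv]; exists (cst v).
  by apply: filterS (Fs x) => t /=; rewrite /aut_fun => ->.
move=> /(_ B); rewrite nbhs_simpl; apply.
exact: open_nbhs_nbhs.
Qed.

Lemma near_aut (s : AutP) x : \forall t \near s, aut_fun t x = aut_fun s x.
Proof. exact: (cvg_autP s (nbhs_filter s)).1. Qed.

Lemma aut_mulg_continuous : continuous (fun x : AutP * AutP => (x.1 * x.2)%g).
Proof.
move=> [s t]; apply/cvg_autP => x.
exists ([set u | aut_fun u (aut_fun t x) = aut_fun s (aut_fun t x)],
        [set u | aut_fun u x = aut_fun t x]).
  by split; exact: near_aut.
by move=> [u v] [/= us vt]; rewrite !aut_funM vt us.
Qed.

Lemma aut_invg_continuous : continuous (fun x : AutP => x^-1%g).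
Proof.
move=> s; apply: (iffRL (cvg_autP _ (fmap_filter _ (nbhs_filter s)))) => x.
apply: filterS (near_aut s (aut_fun s^-1%g x)) => t /= ts.
by apply: (can_inj (aut_funK t)); rewrite aut_funVK ts aut_funVK.
Qed.

HB.instance Definition _ := PreTopologicalGroup_isTopologicalGroup.Build AutP
  aut_mulg_continuous aut_invg_continuous.

End Aut.

Notation borel G := (g_sigma_algebraType (@open G)).

Section Haar.
Context {R : realType} {G : topologicalGroupType}.
Implicit Types mu : {measure set (borel G) -> \bar R}.
Local Open Scope ereal_scope.

Definition radon mu : Prop :=
  [/\ forall K : set G, compact K -> mu K < +oo,
      forall A : set (borel G), measurable A ->
        mu A = ereal_inf [set mu U | U in [set U : set G | open U /\ A `<=` U]]
    & forall U : set G, open U ->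
        mu U = ereal_sup [set mu K | K in [set K : set G | compact K /\ K `<=` U]]].

Definition left_invariant mu : Prop :=
  forall (g : G) (A : set (borel G)), measurable A ->
    mu [set (g * x)%g | x in A] = mu A.

Definition right_invariant mu : Prop :=
  forall (g : G) (A : set (borel G)), measurable A ->
    mu [set (x * g)%g | x in A] = mu A.

Definition left_haar mu : Prop :=
  [/\ radon mu, left_invariant mu & mu [set: G] != 0].

(* A mean on L^oo(mu), seen as a functional on essentially bounded Borel
   functions that only depends on their classes modulo mu-a.e. equality. *)
Definition left_invariant_mean mu (m : (borel G -> R) -> R) : Prop :=
  [/\ {in Lfun mu +oo &, forall f h, f = h %[ae mu] -> m f = m h},
      forall a : R, {in Lfun mu +oo &, forall f h,
        m (fun x => a * f x + h x)%R = (a * m f + m h)%R},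
      {in Lfun mu +oo, forall f,
        {ae mu, forall x, (0 <= f x)%R} -> (0 <= m f)%R},
      m (cst 1%R) = 1%R
    & forall g : G, {in Lfun mu +oo, forall f,
        m (fun x : G => f (g * x)%g) = m f}].

End Haar.

Definition unimodular (R : realType) (G : topologicalGroupType) : Prop :=
  exists mu : {measure set (borel G) -> \bar R},
    left_haar mu /\ right_invariant mu.

(* By uniqueness of Haar measure up to scaling, L^oo(mu) does not depend on the
   choice of mu. *)
Definition amenable (R : realType) (G : topologicalGroupType) : Prop :=
  exists mu : {measure set (borel G) -> \bar R},
    left_haar mu /\ exists m, left_invariant_mean mu m.

Definition stochastic (R : realType) (V : choiceType) (P : V -> V -> R) : Prop :=
  (forall x y, 0 <= P x y) /\
  forall x, (\esum_(y in [set: V]) (P x y)%:E = 1)%E.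

Section Graph.
Context {V : eqType} (E : rel V).

Definition is_walk (x y : V) (n : nat) : Prop :=
  exists p : seq V, [/\ path E x p, last x p = y & size p = n].

Definition connected_graph : Prop := forall x y, exists n, is_walk x y n.

(* Junk value 0 when x and y are not connected. *)
Definition graph_dist (x y : V) : nat :=
  if pselect (exists n, `[< is_walk x y n >]) is left h then ex_minn h else 0%N.

End Graph.

Definition is_min (R : realType) (A : set R) (a : R) : Prop :=
  A a /\ forall b, A b -> a <= b.

Record hilbertSpace (R : realType) := HilbertSpace {
  hilbert_sort :> completeNormedModType R ;
  inner : {dot hilbert_sort for idfun} ;
  innerE : forall u, inner u u = `|u| ^+ 2
}.

Record affine_isometric_action (R : realType) (G : groupType)
    (H : normedModType R) (pi : G -> H -> H) : Prop := {
  action1 : forall v, pi 1%g v = v ;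
  actionM : forall g h v, pi (g * h)%g v = pi g (pi h v) ;
  action_affine : forall g (t : R) u v,
    pi g (t *: u + (1 - t) *: v) = t *: pi g u + (1 - t) *: pi g v ;
  action_isometric : forall g u v, `|pi g u - pi g v| = `|u - v|
}.

Definition equivariant_map (R : realType) (V : countType) (P : V -> V -> R)
    (Gamma : groupClosed (AutP P)) (H : normedModType R) (Psi : V -> H) : Prop :=
  exists pi : subgroup Gamma -> H -> H, affine_isometric_action pi /\
    forall g x, pi g (Psi x) = Psi (aut_fun (val g) x).

(* The sum over V is unconditional: the net of its finite partial sums
   converges in norm. *)
Definition harmonic_map (R : realType) (V : choiceType) (P : V -> V -> R)
    (H : normedModType R) (Psi : V -> H) : Prop :=
  forall x, summability.partial_sum (fun y => P x y *: Psi y)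
    @ summability.totally --> Psi x.

(* Main.v *)
From HB Require Import structures.
Require Import Defs.
From mathcomp Require Import all_boot all_order all_algebra finmap.
From mathcomp Require Import all_classical all_reals all_analysis.
From mathcomp Require Import lra.
From mathcomp.analysis.showcase Require summability.
Set Implicit Arguments.
Unset Strict Implicit.
Unset Printing Implicit Defensive.
Import Order.TTheory GRing.Theory Num.Theory.
Import numFieldNormedType.Exports.
Local Open Scope classical_set_scope.
Local Open Scope ring_scope.

(** Let T = (1 + P) / 2, p n = T^n (o, o) and d n = p n - p n.+1.  Write N_k (x, y) for
    |T^k 1_x - T^k 1_y|^2 / (4 d (2k)), that is, (p (2k) - T^(2k) (x, y)) / (2 d (2k)).  This
    kernel is Gamma-invariant and of negative type, and sum_y P (x, y) N_k (x, y) = 1; hence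
    N_k <= 1 / pstar on edges and N_k (x, y) <= dist (x, y)^2 / pstar.  The distance from x |->
    T^k 1_x to harmonicity, in the same normalisation, is controlled by 1 - d (2k+1) / d (2k).
    Along a sequence of k for which this tends to 0, a limit of N_k along an ultrafilter is the
    squared distance of a Gamma-equivariant harmonic map into a Hilbert space; the second moment
    condition gives sum_y P (x, y) N (x, y) = 1 in the limit, so the map is not constant.

    Such a sequence exists: otherwise d (2k), and then p (2k) as V is infinite, decays
    exponentially, and h = sum_k s^-k T^(2k) (., o) satisfies T^2 h <= s h for some s < 1.  The
    antisymmetric flow T^2 (x, y) (h x - h y) / (h x + h y) then has divergence at least
    (1 - s) / 2 at every vertex.  Averaging it over Gamma with the invariant mean gives a
    Gamma-invariant antisymmetric flow with positive divergence, which contradicts the mass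
    transport principle of the unimodular group Gamma. *)

(** * Unconditional sums *)

Lemma cvg_seq_sum (R : realType) (A I : Type) (F : set_system A)
    (FF : Filter F) (r : seq I) (f : A -> I -> R) (l : I -> R) :
  (forall i, f ^~ i @ F --> l i) ->
  (fun k => \sum_(i <- r) f k i) @ F --> \sum_(i <- r) l i.
Proof.
move=> fl; elim: r => [|i r IH].
  by rewrite big_nil; under eq_fun do rewrite big_nil; exact: cvg_cst.
by rewrite big_cons; under eq_fun do rewrite big_cons; apply: cvgD.
Qed.

Lemma cvg_le_cst (R : realType) (A : Type) (F : set_system A)
    {FF : ProperFilter F} (f : A -> R) (l c : R) :
  f @ F --> l -> (\forall k \near F, f k <= c) -> l <= c.
Proof.
move=> fl fc; apply: (closed_cvg (fun x => x <= c) _ _ l fl) => /=; [exact: closed_le|exact: fc].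
Qed.

#[local] Existing Instance summability.totally_filter.

Section HasSum.
Context {R : realType} {I : choiceType}.
Implicit Types (f g b : I -> R) (s : R) (J : {fset I}).

(** The inductive wrapper keeps the convergence from being unfolded into an inclusion of filters by
    [apply]. *)
Variant has_sum f s : Prop :=
  HasSum of summability.partial_sum f @ summability.totally --> s.

Lemma partial_sumE (H : zmodType) (f : I -> H) J :
  summability.partial_sum f J = \sum_(i <- J) f i.
Proof. by rewrite /summability.partial_sum big_seq_fsetE. Qed.

Lemma has_sumP f s : has_sum f s <-> forall e, 0 < e ->
  exists J0, forall J, fsubset J0 J -> `|s - \sum_(i <- J) f i| <= e.
Proof.
split=> [[/cvgrPdist_le fs] e e0|fs].
  have [J0 _ H] := fs e e0; exists J0 => J J0J.
  by rewrite -partial_sumE; exact: H.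
constructor; apply/cvgrPdist_le => e e0; have [J0 H] := fs e e0.
by exists J0 => // J J0J /=; rewrite partial_sumE; exact: H.
Qed.

Lemma has_sum_unique f s s' : has_sum f s -> has_sum f s' -> s = s'.
Proof. by move=> [fs] [fs']; exact: (@cvg_unique _ (@norm_hausdorff R R^o)) fs fs'. Qed.

Lemma eq_has_sum f g s : f =1 g -> has_sum f s -> has_sum g s.
Proof. by move=> /funext ->. Qed.

Lemma has_sum0 : has_sum (fun=> 0) 0.
Proof.
by apply/has_sumP => e e0; exists fset0 => J _; rewrite big1// subr0 normr0 ltW.
Qed.

Lemma has_sumD f g s s' : has_sum f s -> has_sum g s' ->
  has_sum (fun i => f i + g i) (s + s').
Proof.
move=> [fs] [gs]; constructor.
have -> : summability.partial_sum (fun i => f i + g i) =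
    summability.partial_sum f \+ summability.partial_sum g.
  by apply/funext => J; rewrite !partial_sumE big_split /= !partial_sumE.
exact: cvgD fs gs.
Qed.

Lemma has_sumZ f s (a : R) : has_sum f s -> has_sum (fun i => a * f i) (a * s).
Proof.
move=> [fs]; constructor.
have -> : summability.partial_sum (fun i => a * f i) =
    (fun J => a * summability.partial_sum f J).
  by apply/funext => J; rewrite !partial_sumE mulr_sumr.
exact: cvgMr fs.
Qed.

Lemma has_sumB f g s s' : has_sum f s -> has_sum g s' ->
  has_sum (fun i => f i - g i) (s - s').
Proof.
move=> fs gs0; have gs := has_sumZ (-1) gs0; rewrite -mulN1r.
by apply: eq_has_sum (has_sumD fs gs) => i; rewrite mulN1r.
Qed.

Lemma has_sum_sum (A : Type) (r : seq A) (f : A -> I -> R) (s : A -> R) :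
  (forall a, has_sum (f a) (s a)) ->
  has_sum (fun i => \sum_(a <- r) f a i) (\sum_(a <- r) s a).
Proof.
move=> fs; elim: r => [|a r IH].
  by rewrite big_nil; apply: eq_has_sum has_sum0 => i; rewrite big_nil.
rewrite big_cons; apply: eq_has_sum (has_sumD (fs a) IH) => i.
by rewrite big_cons.
Qed.

Lemma has_sum_le f g s s' : (forall i, f i <= g i) ->
  has_sum f s -> has_sum g s' -> s <= s'.
Proof.
move=> fg fs gs.
have h := has_sumB gs fs; rewrite -subr_ge0; apply/ler_addgt0Pr => e e0.
have [J /(_ J (fsubset_refl J))] := (has_sumP _ _).1 h e e0.
have : 0 <= \sum_(i <- J) (g i - f i) by apply: sumr_ge0 => i _; rewrite subr_ge0.
by rewrite ler_norml => ? /andP[? ?]; lra.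
Qed.

Lemma has_sum_ge0 f s : (forall i, 0 <= f i) -> has_sum f s -> 0 <= s.
Proof. by move=> f0; apply: has_sum_le f0 _; exact: has_sum0. Qed.

Lemma sum_fsubsetD f J J' : fsubset J J' ->
  \sum_(i <- J') f i = \sum_(i <- J) f i + \sum_(i <- (J' `\` J)%fset) f i.
Proof.
move=> JJ'; rewrite (big_fsetID _ (mem J)) /=; congr (_ + _).
  suff -> : [fset i in J' | i \in J]%fset = J by [].
  by apply/fsetP => i; rewrite !inE/= andb_idl//; exact: (fsubsetP JJ').
suff -> : [fset i in J' | i \notin J]%fset = (J' `\` J)%fset by [].
by apply/fsetP => i; rewrite !inE/= andbC.
Qed.

Lemma ge0_sum_fsubset f J J' : (forall i, 0 <= f i) -> fsubset J J' ->
  \sum_(i <- J) f i <= \sum_(i <- J') f i.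
Proof.
by move=> f0 JJ'; rewrite (sum_fsubsetD f JJ') lerDl sumr_ge0.
Qed.

Lemma has_sum_ge_partial f s J : (forall i, 0 <= f i) -> has_sum f s ->
  \sum_(i <- J) f i <= s.
Proof.
move=> f0 /has_sumP fs; apply/ler_addgt0Pr => e e0.
have [J0 H] := fs e e0.
have := H _ (fsubsetUl J0 J); rewrite ler_norml => /andP[+ _].
have : \sum_(i <- J) f i <= \sum_(i <- (J0 `|` J)%fset) f i.
  by apply: ge0_sum_fsubset => //; exact: fsubsetUr.
lra.
Qed.

Lemma has_sum_ge_term f s i : (forall i, 0 <= f i) -> has_sum f s -> f i <= s.
Proof.
by move=> f0 fs; have := has_sum_ge_partial [fset i]%fset f0 fs; rewrite big_seq_fset1.
Qed.

Lemma esum_fsetE f J : (forall i, 0 <= f i) ->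
  \esum_(i in [set` J]) (f i)%:E = (\sum_(i <- J) f i)%:E.
Proof.
move=> f0; rewrite esum_fset//; last by move=> i _; rewrite lee_fin.
by rewrite -sumEFin fsbig_finite//= set_fsetK.
Qed.

(** For nonnegative families the net of finite sums increases to its supremum. This is the bridge
    through which reindexing and Fubini are imported from [esum]. *)
Lemma has_sum_esum f s : (forall i, 0 <= f i) ->
  has_sum f s <-> \esum_(i in setT) (f i)%:E = s%:E.
Proof.
move=> f0; split=> [fs|fs].
  apply/eqP; rewrite eq_le; apply/andP; split.
    apply: ge_ereal_sup => _ [A [finA _] <-].
    rewrite fsbig_finite//= sumEFin lee_fin.
    exact: has_sum_ge_partial.
  apply/lee_addgt0Pr => e e0; move/has_sumP : fs => /(_ e e0)[J0 /(_ J0)].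
  rewrite fsubset_refl => /(_ isT); rewrite ler_norml => /andP[_].
  rewrite lerBlDr => H.
  apply: (@le_trans _ _ ((\sum_(i <- J0) f i)%:E + e%:E)%E).
    by rewrite -EFinD lee_fin addrC.
  rewrite leeD2r// -esum_fsetE//; apply: esum_ge; exists [set` J0]; first by split.
  by rewrite esum_fset//= => i _; rewrite lee_fin.
apply/has_sumP => e e0.
have := @ub_ereal_sup_adherent R [set (\sum_(x \in A) (f x)%:E)%E | A in fsets [set: I]] e e0.
rewrite -/(esum setT (fun i => (f i)%:E)) fs => /(_ isT)[_ [A [finA _] <-]].
rewrite -EFinB fsbig_finite//= sumEFin lte_fin => lt.
exists (fset_set A) => J AJ.
have le1 := ge0_sum_fsubset f0 AJ.
have : ((\sum_(i <- J) f i)%:E <= s%:E)%E.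
  rewrite -esum_fsetE// -fs; apply: esum_ge; exists [set` J]; first by split.
  by rewrite esum_fset//= => i _; rewrite lee_fin.
by rewrite lee_fin ler_norml => ?; apply/andP; split; lra.
Qed.

Lemma esum_has_sum f : (forall i, 0 <= f i) ->
  (\esum_(i in setT) (f i)%:E < +oo)%E -> exists s, has_sum f s.
Proof.
move=> f0 fin; exists (fine (\esum_(i in setT) (f i)%:E)).
apply/has_sum_esum => //; rewrite fineK// ge0_fin_numE//.
by apply: esum_ge0 => i _; rewrite lee_fin.
Qed.

Lemma has_sum_dom f b s : (forall i, 0 <= f i <= b i) -> has_sum b s ->
  exists s', has_sum f s'.
Proof.
move=> fb bs; apply: esum_has_sum => [i|]; first by case/andP: (fb i).
have b0 i : 0 <= b i by case/andP: (fb i); exact: le_trans.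
apply: (@le_lt_trans _ _ s%:E); last exact: ltry.
rewrite -((has_sum_esum s b0).1 bs); apply: le_esum => i _.
by rewrite lee_fin; case/andP: (fb i).
Qed.

(** The shifted family [f + b] lies between [0] and [2 * b], so the nonnegative case applies; then
    [b] is subtracted again. *)
Lemma has_sum_abs_dom f b s : (forall i, `|f i| <= b i) -> has_sum b s ->
  exists s', has_sum f s'.
Proof.
move=> fb bs.
have [i|s1 h1] := @has_sum_dom (fun i => f i + b i) (fun i => 2 * b i) (2 * s) _ (has_sumZ (2) bs).
  by have := fb i; rewrite ler_norml => /andP[? ?]; apply/andP; split; lra.
exists (s1 - s); apply: eq_has_sum (has_sumB h1 bs) => i; lra.
Qed.

Lemma has_sum_tail b s e : (forall i, 0 <= b i) -> has_sum b s -> 0 < e ->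
  exists J0, forall J, fdisjoint J0 J -> \sum_(i <- J) b i <= e.
Proof.
move=> b0 bs e0; have /has_sumP/(_ e e0)[J0 H] := bs.
exists J0 => J J0J.
have := H _ (fsubset_refl J0); rewrite ler_norml => /andP[_ ?].
have := has_sum_ge_partial (J0 `|` J)%fset b0 bs.
have -> : \sum_(i <- (J0 `|` J)%fset) b i = \sum_(i <- J0) b i + \sum_(i <- J) b i.
  rewrite (sum_fsubsetD b (fsubsetUl J0 J)) fsetDUl fsetDv fset0U.
  by rewrite (_ : (J `\` J0)%fset = J)//; apply/fsetDidPl; rewrite fdisjoint_sym.
lra.
Qed.

(** The set [J0] depends on the majorant [b] only, so the estimate is uniform over all [f] dominated
    by [b]. This uniformity drives dominated convergence and the truncations further on. *)
Lemma has_sum_tail_le f b s e J0 :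
  (forall i, `|f i| <= b i) -> has_sum f s ->
  (forall J, fdisjoint J0 J -> \sum_(i <- J) b i <= e) ->
  forall J, fsubset J0 J -> `|s - \sum_(i <- J) f i| <= e.
Proof.
move=> fb /has_sumP fs tail J J0J; apply/ler_addgt0Pr => eta eta0.
have [J1 H] := fs eta eta0.
have := H _ (fsubsetUl J1 J).
have JJ : fsubset J (J1 `|` J)%fset by exact: fsubsetUr.
rewrite (sum_fsubsetD f JJ).
set D := ((_ `|` _) `\` _)%fset.
have : `|\sum_(i <- D) f i| <= e.
  apply: (le_trans (ler_norm_sum _ _ _)).
  apply: (@le_trans _ _ (\sum_(i <- D) b i)); first exact: ler_sum.
  apply: tail; rewrite fdisjoint_sym; apply/fdisjointP => i.
  by rewrite inE => /andP[iJ _]; apply: contra iJ; exact: (fsubsetP J0J).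
set u := \sum_(i <- D) _; set v := \sum_(i <- J) _ => ue h.
have -> : s - v = (s - (v + u)) + u by lra.
by apply: (le_trans (ler_normD _ _)); rewrite addrC lerD.
Qed.

(** Dominated convergence along any proper filter: the truncation error at [J] is at most [e] for
    every [k], and this bound on a finite sum survives the limit. *)
Lemma has_sum_cvg (A : Type) (F : set_system A) {FF : ProperFilter F}
    (f : A -> I -> R) (b : I -> R) (sb : R) (s : A -> R) (f' : I -> R) (s' : R) :
  (forall k i, `|f k i| <= b i) -> has_sum b sb ->
  (forall k, has_sum (f k) (s k)) ->
  (forall i, f ^~ i @ F --> f' i) -> s @ F --> s' -> has_sum f' s'.
Proof.
move=> fb bs fs ff' ss'; apply/has_sumP => e e0.
have b0 i : 0 <= b i.
  by have [k _] := filter_ex (@filterT _ F _); exact: le_trans (fb k i).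
have [J0 tail] := has_sum_tail b0 bs e0.
exists J0 => J J0J.
have : (fun k => `|s k - \sum_(i <- J) f k i|) @ F --> `|s' - \sum_(i <- J) f' i|.
  apply: cvg_norm; apply: cvgB => //.
  exact: cvg_seq_sum.
move=> /cvg_le_cst; apply; apply: filterE => k.
exact: (has_sum_tail_le (fb k) (fs k) tail).
Qed.

End HasSum.

(** * The reproducing kernel Hilbert space of a positive semidefinite kernel *)

Lemma discriminant_le (R : realFieldType) (a b c : R) : 0 <= c ->
  (forall l, 0 <= a - 2 * l * b + l ^+ 2 * c) -> b ^+ 2 <= a * c.
Proof.
move=> c0 H; have [c_eq0|c_neq0] := eqVneq c 0.
  rewrite c_eq0 mulr0; have [->|b0] := eqVneq b 0; first by rewrite expr0n.
  (* At this [u] the affine function [a - 2 * u * b] takes the value [-1], which is absurd. *)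
  pose u := (a + 1) / 2 / b; have ub : u * b = (a + 1) / 2 by rewrite divfK.
  have := H u; rewrite c_eq0 mulr0 addr0; lra.
have {}c0 : 0 < c by rewrite lt_def c_neq0.
(* The minimum of the quadratic is at [b / c]. *)
have := H (b / c); have -> : a - 2 * (b / c) * b + (b / c) ^+ 2 * c = a - b ^+ 2 / c.
  have : (b / c) * c = b by rewrite divfK.
  rewrite expr2; set u := b / c => uc.
  have -> : u * u * c = u * b by rewrite -mulrA uc.
  have -> : b ^+ 2 / c = u * b by rewrite expr2 -mulrA [in LHS]mulrC /u.
  lra.
by rewrite subr_ge0 ler_pdivrMr.
Qed.

(** * Bilinearity of the polar form under the parallelogram law *)

Section JordanVonNeumann.
Context {R : realType} {H : lmodType R}.
Variable q : H -> R.
Hypotheses (q_ge0 : forall u, 0 <= q u)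
  (qZ : forall a u, q (a *: u) = a ^+ 2 * q u)
  (q_parallelogram : forall u v, q (u + v) + q (u - v) = 2 * q u + 2 * q v).

Definition polar u v : R := (q (u + v) - q (u - v)) / 4.

Lemma polarC u v : polar u v = polar v u.
Proof.
rewrite /polar (addrC v); congr ((_ - _) / _).
by rewrite -(opprB v u) -(scaleN1r (v - u)) qZ sqrrN expr1n mul1r.
Qed.

Lemma polarxx u : polar u u = q u.
Proof.
rewrite /polar subrr -mulr2n -scaler_nat qZ.
have := qZ 0 0; rewrite scaler0 expr0n mul0r => ->; lra.
Qed.

(** Difference of the parallelogram laws for [(u + v, w)] and [(u - v, w)]. *)
Lemma polar_avg u w v : polar (u + w) v + polar (u - w) v = 2 * polar u v.
Proof.
rewrite /polar.
have := q_parallelogram (u + v) w; have := q_parallelogram (u - v) w.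
have -> : u + v + w = u + w + v by rewrite addrAC.
have -> : u + v - w = u - w + v by rewrite addrAC.
have -> : u - v + w = u + w - v by rewrite addrAC.
have -> : u - v - w = u - w - v by rewrite addrAC.
lra.
Qed.

Lemma polar0 v : polar 0 v = 0.
Proof. by rewrite polarC /polar addr0 subr0 subrr mul0r. Qed.

(** [polar_avg] is applied to the half sum and the half difference of [u] and [w]. *)
Lemma polarD u w v : polar (u + w) v = polar u v + polar w v.
Proof.
have h x : polar (2 *: x) v = 2 * polar x v.
  by rewrite -(polar_avg x x) subrr polar0 addr0 scaler_nat mulr2n.
pose a := 2^-1 *: (u + w); pose b := 2^-1 *: (u - w).
have <- : 2 *: a = u + w by rewrite scalerA mulfV ?scale1r// pnatr_eq0.
have half x : 2^-1 *: (x + x) = x :> H.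
  by rewrite scalerDr -scalerDl -[RHS]scale1r; congr (_ *: _); lra.
rewrite h -(polar_avg a b) /a /b -scalerDr -scalerBr; congr (polar _ _ + polar _ _).
  by rewrite addrACA subrr addr0 half.
by rewrite opprB (addrC w (- u)) addrACA subrr add0r half.
Qed.

Lemma polarN u v : polar (- u) v = - polar u v.
Proof. by apply/eqP; rewrite -addr_eq0 -polarD addNr polar0. Qed.

Lemma polarMn u v n : polar (u *+ n) v = n%:R * polar u v.
Proof.
elim: n => [|n IH]; first by rewrite mulr0n polar0 mul0r.
by rewrite mulrS polarD IH -natr1; lra.
Qed.

Lemma polar_bound a u v : `|polar (a *: u) v| <= (a ^+ 2 * q u + q v).
Proof.
have := q_parallelogram (a *: u) v; rewrite qZ => h.
have := q_ge0 (a *: u + v); have := q_ge0 (a *: u - v).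
by rewrite /polar ler_norml => ? ?; apply/andP; split; lra.
Qed.

(* psi a = <a u, v> - a <u, v> is additive and bounded on [0, 1] with psi 1 = 0,
   hence bounded on R, hence zero. *)
Lemma polarZ a u v : polar (a *: u) v = a * polar u v.
Proof.
pose psi a := polar (a *: u) v - a * polar u v.
have psiD x y : psi (x + y) = psi x + psi y.
  by rewrite /psi scalerDl polarD; lra.
have psiMn x n : psi (x *+ n) = n%:R * psi x.
  by rewrite /psi -scalerMnl polarMn -mulr_natl; lra.
have psi1 : psi 1 = 0 by rewrite /psi scale1r; lra.
have psiN x : psi (- x) = - psi x by rewrite /psi scaleNr polarN; lra.
have psiZ (m : int) : psi m%:~R = 0.
  by case: m => n; rewrite ?NegzE ?mulrNz ?psiN -pmulrn psiMn psi1 mulr0 ?oppr0.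
pose M := q u + q v + `|polar u v|.
have psi_le x : `|psi x| <= M.
  have -> : psi x = psi (x - (Num.floor x)%:~R) by rewrite psiD psiN psiZ subr0.
  set y := x - _; have /andP[y0 y1] : 0 <= y <= 1.
    by have := floor_itv x; rewrite intrD /y => /andP[? ?]; apply/andP; split; lra.
  rewrite /psi; apply: (le_trans (ler_normB _ _)); apply: lerD.
    apply: le_trans (polar_bound _ _ _) _; rewrite lerD2r ler_piMl//.
    by rewrite exprn_ile1.
  by rewrite normrM (ger0_norm y0) ler_piMl.
suff /eqP : psi a = 0 by rewrite subr_eq0 => /eqP.
apply/eqP; rewrite -normr_le0; apply/ler_addgt0Pr => e e0; rewrite add0r.
pose n := (Num.truncn (M / e)).+1.
have : M / e < n%:R by exact: truncnS_gt.
rewrite ltr_pdivrMr// => Mn.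
have n0 : 0 < n%:R :> R by rewrite ltr0n.
rewrite -(ler_pM2l n0); apply: le_trans (ltW Mn).
by rewrite -(ger0_norm (ltW n0)) -normrM -psiMn.
Qed.

End JordanVonNeumann.

Record psd_kernel (R : realType) (I : Type) := PsdKernel {
  ker :> I -> I -> R;
  ker_sym : forall i j, ker i j = ker j i;
  ker_psd : forall t : seq (R * I),
    0 <= \sum_(a <- t) \sum_(b <- t) a.1 * b.1 * ker a.2 b.2
}.

(** * Finite combinations of kernel functions, the norm they define, and completeness *)

Section Rkhs.
Context {R : realType} {I : Type}.
Implicit Types (f g : I -> R) (s t : seq (R * I)) (K : psd_kernel R I).

(** A list [t] of weighted points stands for the combination of the kernel functions [K i] with
    these weights. By the reproducing property [ev f t] is the inner product of [f] with it. *)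
Definition ev f t : R := \sum_(a <- t) a.1 * f a.2.

Definition scale_comb (c : R) t : seq (R * I) := [seq (c * a.1, a.2) | a <- t].

Lemma ev_cat f s t : ev f (s ++ t) = ev f s + ev f t.
Proof. by rewrite /ev big_cat. Qed.

Lemma ev_scale c f t : ev f (scale_comb c t) = c * ev f t.
Proof. by rewrite /ev big_map mulr_sumr; apply: eq_bigr => a _; rewrite mulrA. Qed.

Lemma ev1 f i : ev f [:: (1, i)] = f i.
Proof. by rewrite /ev big_seq1 mul1r. Qed.

Lemma evD f g t : ev (f + g) t = ev f t + ev g t.
Proof. by rewrite /ev -big_split; apply: eq_bigr => a _; rewrite /= -mulrDr. Qed.

Lemma evZ c f t : ev (c *: f) t = c * ev f t.
Proof. by rewrite /ev mulr_sumr; apply: eq_bigr => a _; rewrite /= mulrCA. Qed.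

Lemma evB f g t : ev (f - g) t = ev f t - ev g t.
Proof. by rewrite -scaleN1r evD evZ mulN1r. Qed.

Section Form.
Variable K : psd_kernel R I.

Definition gram s t : R := ev (fun i => ev (K i) t) s.

Lemma gramE s t : gram s t = \sum_(a <- s) \sum_(b <- t) a.1 * b.1 * K a.2 b.2.
Proof.
apply: eq_bigr => a _; rewrite /ev mulr_sumr; apply: eq_bigr => b _.
by rewrite mulrA.
Qed.

Lemma gram_sym s t : gram s t = gram t s.
Proof.
rewrite !gramE exchange_big; apply: eq_bigr => a _; apply: eq_bigr => b _.
by rewrite ker_sym (mulrC a.1).
Qed.

Lemma gram_ge0 t : 0 <= gram t t.
Proof. by rewrite gramE; exact: ker_psd. Qed.

Lemma gram_comb c s t : gram (s ++ scale_comb c t) (s ++ scale_comb c t) =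
  gram s s + 2 * c * gram s t + c ^+ 2 * gram t t.
Proof.
have gl u v w : gram (u ++ scale_comb c v) w = gram u w + c * gram v w.
  by rewrite /gram ev_cat ev_scale.
rewrite gl gram_sym gl [in X in _ + c * X]gram_sym gl (gram_sym t s); lra.
Qed.

Lemma gram_scale c t : gram (scale_comb c t) (scale_comb c t) = c ^+ 2 * gram t t.
Proof.
rewrite {1}/gram ev_scale -/(gram t (scale_comb c t)) gram_sym {1}/gram ev_scale.
by rewrite mulrA -expr2.
Qed.

Lemma gram_CauchySchwarz s t : gram s t ^+ 2 <= gram s s * gram t t.
Proof.
apply: discriminant_le => [|l]; first exact: gram_ge0.
have := gram_ge0 (s ++ scale_comb (- l) t); rewrite gram_comb sqrrN; lra.
Qed.

(** This says that [f] has norm at most [c] as a functional on finite combinations. Functions with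
    such a bound form the Hilbert space directly, without a quotient or a completion. *)
Definition ev_le (c : R) f := forall t, `|ev f t| <= c * Num.sqrt (gram t t).

Lemma ev_le_term c f i : ev_le c f -> `|f i| <= c * Num.sqrt (K i i).
Proof.
move=> /(_ [:: (1, i)]).
by rewrite /ev /gram /ev !big_seq1/= !mul1r.
Qed.

(** One direction is [2 * c * b <= c ^+ 2 + b ^+ 2] with [b] the seminorm of [t]; the other rescales
    [t] by [l] and uses the discriminant. The form without square roots makes the squared norm a
    supremum. *)
Lemma ev_leP c f : 0 <= c ->
  ev_le c f <-> forall t, 2 * ev f t - gram t t <= c ^+ 2.
Proof.
move=> c0; split=> H t.
  have := H t; set b := Num.sqrt _; have : b ^+ 2 = gram t t by rewrite sqr_sqrtr// gram_ge0.
  rewrite ler_norml => <- /andP[_ h].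
  have : 0 <= (c - b) ^+ 2 by exact: sqr_ge0.
  rewrite sqrrB; lra.
rewrite -sqrtr_sqr -(ger0_norm c0) -(sqrtr_sqr c) -sqrtrM ?sqr_ge0//.
apply: ler_wsqrtr; apply: discriminant_le => [|l]; first exact: gram_ge0.
have := H (scale_comb l t); rewrite ev_scale.
rewrite gram_scale; lra.
Qed.

Lemma ev_leD c d f g : ev_le c f -> ev_le d g -> ev_le (c + d) (f + g).
Proof.
by move=> Hf Hg t; rewrite evD mulrDl (le_trans (ler_normD _ _))// lerD.
Qed.

Lemma ev_leZ c a f : ev_le c f -> ev_le (`|a| * c) (a *: f).
Proof. by move=> Hf t; rewrite evZ normrM -mulrA ler_wpM2l. Qed.

Lemma ev_le_feature i : ev_le (Num.sqrt (K i i)) (K i).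
Proof.
move=> t; have := gram_CauchySchwarz [:: (1, i)] t.
have K0 := gram_ge0 [:: (1, i)]; move: K0.
rewrite /gram !ev1 -/(gram t t) => K0 h.
by rewrite -sqrtr_sqr -sqrtrM// ler_wsqrtr.
Qed.

Definition rkhs_pred : pred (I -> R) := fun f => `[< exists2 c, 0 <= c & ev_le c f >].

Fact rkhs_submod_closed : submod_closed rkhs_pred.
Proof.
split=> [|a f g /asboolP[c c0 Hf] /asboolP[d d0 Hg]]; apply/asboolP.
  by exists 0 => // t; rewrite /ev mul0r big1 ?normr0// => a _; rewrite mulr0.
by exists (`|a| * c + d); [rewrite addr_ge0// mulr_ge0|apply: ev_leD => //; exact: ev_leZ].
Qed.

HB.instance Definition _ :=
  GRing.isSubmodClosed.Build R (I -> R) rkhs_pred rkhs_submod_closed.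

Record rkhs := Rkhs { rkhs_fun :> I -> R; rkhsP : rkhs_fun \in rkhs_pred }.

HB.instance Definition _ := [isSub for rkhs_fun].
HB.instance Definition _ := [Choice of rkhs by <:].
HB.instance Definition _ := [SubChoice_isSubLmodule of rkhs by <:].

Lemma rkhs_ext (u v : rkhs) : (forall i, u i = v i) -> u = v.
Proof. by move=> uv; apply/val_inj/funext. Qed.

Lemma rkhs_funD (u v : rkhs) i : (u + v) i = u i + v i. Proof. by []. Qed.

Lemma rkhs_funB (u v : rkhs) i : (u - v) i = u i - v i. Proof. by []. Qed.

Lemma rkhs_funZ a (u : rkhs) i : (a *: u) i = a * u i. Proof. by []. Qed.

(** The squared norm written as a Legendre transform: no division by [gram t t], which may vanish,
    and test combinations can be recombined linearly. *)
Definition qform (f : rkhs) : R := sup [set 2 * ev f t - gram t t | t in [set: seq (R * I)]].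

Lemma qform_leP (f : rkhs) c : 0 <= c -> qform f <= c ^+ 2 <-> ev_le c f.
Proof.
move=> c0; rewrite ev_leP//; have /asboolP[d d0 /(ev_leP _ d0) Hd] := rkhsP f.
have fsup : has_sup [set 2 * ev f t - gram t t | t in [set: seq (R * I)]].
  by split; [exists (2 * ev f [::] - gram [::] [::]), [::]|
             exists (d ^+ 2) => _ [t _ <-]; exact: Hd].
split=> [h t|h].
  by apply: le_trans h; apply: sup_upper_bound => //; exists t.
by apply: sup_le_ub; [case: fsup|move=> _ [t _ <-]; exact: h].
Qed.

Lemma qform_ge0 (f : rkhs) : 0 <= qform f.
Proof.
have /asboolP[d d0 /(ev_leP _ d0) Hd] := rkhsP f.
apply: (@le_trans _ _ (2 * ev f [::] - gram [::] [::])).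
  by rewrite /gram /ev !big_nil mulr0 subr0.
apply: sup_upper_bound; last by exists [::].
by split; [exists (2 * ev f [::] - gram [::] [::]), [::]|
             exists (d ^+ 2) => _ [t _ <-]; exact: Hd].
Qed.

Lemma qform_ev (f : rkhs) : ev_le (Num.sqrt (qform f)) f.
Proof. by apply/qform_leP; rewrite ?sqrtr_ge0// sqr_sqrtr// qform_ge0. Qed.

Lemma qform_sqrt_le (f : rkhs) c : 0 <= c -> ev_le c f -> Num.sqrt (qform f) <= c.
Proof.
by move=> c0 /(qform_leP _ c0) h; rewrite -(ger0_norm c0) -sqrtr_sqr ler_wsqrtr.
Qed.

Lemma qformZ a (f : rkhs) : qform (a *: f) = a ^+ 2 * qform f.
Proof.
have le b (g : rkhs) : qform (b *: g) <= b ^+ 2 * qform g.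
  rewrite -[X in _ <= _ * X](sqr_sqrtr (qform_ge0 g)) -(real_normK (num_real b)) -exprMn.
  by apply/qform_leP; rewrite ?mulr_ge0 ?sqrtr_ge0//; apply: ev_leZ; exact: qform_ev.
apply/eqP; rewrite eq_le le/=; have [->|a0] := eqVneq a 0.
  by rewrite expr0n mul0r qform_ge0.
have := le a^-1 (a *: f); rewrite scalerA mulVf// scale1r exprVn.
by rewrite ler_pdivlMl ?exprn_even_gt0.
Qed.

(** Test combinations [s] for [u + v] and [t] for [u - v] give [(s + t) / 2] for [u] and
    [(s - t) / 2] for [v], whence one inequality. The same inequality for [f + g] and [f - g] is the
    reverse one. *)
Lemma qform_parallelogram (f g : rkhs) :
  qform (f + g) + qform (f - g) = 2 * qform f + 2 * qform g.
Proof.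
have evl (h : rkhs) t : 2 * ev h t - gram t t <= qform h.
  rewrite -[leRHS]sqr_sqrtr ?qform_ge0//; move: t; apply/ev_leP; first exact: sqrtr_ge0.
  exact: qform_ev.
have comb s t c : gram (s ++ scale_comb c t) (s ++ scale_comb c t) =
    gram s s + 2 * c * gram s t + c ^+ 2 * gram t t by exact: gram_comb.
have le (u v : rkhs) : qform (u + v) + qform (u - v) <= 2 * qform u + 2 * qform v.
  have H1 s t : (2 * ev (u + v) s - gram s s) + (2 * ev (u - v) t - gram t t) <=
      2 * qform u + 2 * qform v.
    pose a := scale_comb 2^-1 (s ++ scale_comb 1 t).
    pose b := scale_comb 2^-1 (s ++ scale_comb (- 1) t).
    have := evl u a; have := evl v b.
    rewrite /a /b !gram_scale !comb !ev_scale !ev_cat !ev_scale evD evB; lra.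
  have sup_le (h : rkhs) c : (forall t, 2 * ev h t - gram t t <= c) -> qform h <= c.
    move=> H; apply: ge_sup; first by exists (2 * ev h [::] - gram [::] [::]), [::].
    by move=> _ [t _ <-]; exact: H.
  rewrite -lerBrDr; apply: (sup_le) => s; rewrite lerBrDr addrC -lerBrDr.
  by apply: (sup_le) => t; rewrite lerBrDr addrC; exact: H1.
apply/eqP; rewrite eq_le le/=.
have := le (f + g) (f - g).
have -> : f + g + (f - g) = 2 *: f by rewrite addrACA subrr addr0 -mulr2n scaler_nat.
have -> : f + g - (f - g) = 2 *: g by rewrite opprB (addrC (g : rkhs) (- f)) addrACA subrr add0r -mulr2n scaler_nat.
rewrite !qformZ; lra.
Qed.

Fact rkhs_normD (f g : rkhs) :
  Num.sqrt (qform (f + g)) <= Num.sqrt (qform f) + Num.sqrt (qform g).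
Proof.
by apply: qform_sqrt_le; rewrite ?addr_ge0 ?sqrtr_ge0//; apply: ev_leD; exact: qform_ev.
Qed.

Fact rkhs_normZ a (f : rkhs) : Num.sqrt (qform (a *: f)) = `|a| * Num.sqrt (qform f).
Proof. by rewrite qformZ sqrtrM ?sqr_ge0// sqrtr_sqr. Qed.

Fact rkhs_norm_eq0 (f : rkhs) : Num.sqrt (qform f) = 0 -> f = 0.
Proof.
move=> f0; apply/val_inj/funext => i; apply/eqP; rewrite -normr_le0.
by have := ev_le_term i (qform_ev f); rewrite f0 mul0r.
Qed.

HB.instance Definition _ :=
  Lmodule_isNormed.Build R rkhs rkhs_normD rkhs_normZ rkhs_norm_eq0.

Lemma rkhs_norm_sqr (f : rkhs) : `|f| ^+ 2 = qform f.
Proof. by rewrite [LHS]sqr_sqrtr// qform_ge0. Qed.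

Lemma rkhs_norm_le (f : rkhs) c : 0 <= c -> ev_le c f -> `|f| <= c.
Proof. exact: qform_sqrt_le. Qed.

Lemma ev_le_norm (f : rkhs) : ev_le `|f| f.
Proof. exact: qform_ev. Qed.

(** Evaluations are Lipschitz, so [F] converges pointwise to some [l]. Bounds on [ev (x - f) t] pass
    to this limit and give both [l] in the space and convergence in norm. *)
Lemma rkhs_complete (F : set_system rkhs) : ProperFilter F -> cauchy F -> cvg F.
Proof.
move=> FF /cauchyP Fc.
have Fb (e : R) : 0 < e -> exists x : rkhs, \forall f \near F, `|x - f| < e.
  move=> e0; have [x Fx] := Fc e e0; exists x.
  by move: Fx; rewrite -ball_normE.
have Fi i : cvg ((fun f : rkhs => f i) @ F).
  apply: cauchy_cvg; apply: cauchy_exP => e e0.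
  (* The added 1 keeps [k] positive when [K i i = 0]. *)
  pose k := Num.sqrt (K i i) + 1.
  have k0 : 0 < k by rewrite ltr_wpDl// sqrtr_ge0.
  have [x Fx] := Fb (e / k) (divr_gt0 e0 k0).
  exists (x i); rewrite -ball_normE /=; apply: filterS Fx => f /= xf.
  have := ev_le_term i (ev_le_norm (x - f)); rewrite /= => h.
  apply: (le_lt_trans h); rewrite ltr_pdivlMr// in xf.
  by apply: le_lt_trans xf; apply: ler_wpM2l => //; rewrite /k lerDl.
pose l i := lim ((fun f : rkhs => f i) @ F).
have Fl t : (fun f : rkhs => ev f t) @ F --> ev l t.
  apply: (@cvg_seq_sum R _ _ F _ t (fun (f : rkhs) a => a.1 * f a.2)) => a.
  by apply: cvgMr; exact: Fi.
have close e : 0 < e -> exists x : rkhs, (\forall f \near F, `|x - f| < e) /\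
    ev_le e (val x - l).
  move=> e0; have [x Fx] := Fb e e0; exists x; split=> // t.
  have : (fun f : rkhs => `|ev x t - ev f t|) @ F --> `|ev x t - ev l t|.
    by apply: cvg_norm; apply: cvgB; [exact: cvg_cst|exact: Fl].
  move=> /cvg_le_cst; rewrite evB; apply.
  apply: filterS Fx => f xf; have := ev_le_norm (x - f) t; rewrite evB => h.
  by apply: le_trans h _; apply: ler_wpM2r; [exact: sqrtr_ge0|exact: ltW].
have lP : l \in rkhs_pred.
  have [x [_ xl]] := close 1 ltr01.
  have : val x - (val x - l) \in rkhs_pred.
    by apply: rpredB; [exact: rkhsP|apply/asboolP; exists 1].
  by rewrite subKr.
apply/cvg_ex; exists (Rkhs lP); apply/cvgrPdist_le => e e0.
have [x [Fx xl]] := close (e / 2) (divr_gt0 e0 (ltr0n _ 2)).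
apply: filterS Fx => f xf.
have : `|x - Rkhs lP| <= e / 2 by apply: rkhs_norm_le => //; rewrite divr_ge0// ltW.
move=> h; have -> : Rkhs lP - f = (x - f) - (x - Rkhs lP).
  by rewrite opprB [RHS]addrC addrA subrK.
by apply: (le_trans (ler_normB _ _)); lra.
Qed.

HB.instance Definition _ := Uniform_isComplete.Build rkhs rkhs_complete.

Definition rkhs_dot (f g : rkhs) : R := polar qform f g.

Let dotl (f : rkhs) : GRing.linear_for *%R (rkhs_dot ^~ f).
Proof.
move=> a u v; rewrite /rkhs_dot polarD ?polarZ//.
all: try exact: qform_parallelogram.
all: try exact: qformZ.
all: exact: qform_ge0.
Qed.

Let dotC (f g : rkhs) : rkhs_dot f g = rkhs_dot g f.
Proof. by apply: polarC; exact: qformZ. Qed.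

Let dot_bilinear : bilinear_for *%R *%R rkhs_dot.
Proof. by split=> f; [exact: dotl|move=> a u v; rewrite !(dotC f); exact: dotl]. Qed.

HB.instance Definition _ := @bilinear_isBilinear.Build R rkhs rkhs R *%R *%R rkhs_dot dot_bilinear.

Let dot_hermitian (f g : rkhs) : rkhs_dot f g = (-1) ^+ false * idfun (rkhs_dot g f).
Proof. by rewrite expr0 mul1r dotC. Qed.

HB.instance Definition _ :=
  isHermitianSesquilinear.Build R rkhs false idfun rkhs_dot dot_hermitian.

Let dot_norm (f : rkhs) : rkhs_dot f f = `|f| ^+ 2.
Proof. by rewrite rkhs_norm_sqr; apply: polarxx; exact: qformZ. Qed.

Let dot_gt0 (f : rkhs) : f != 0 -> 0 < rkhs_dot f f.
Proof. by move=> f0; rewrite dot_norm exprn_gt0// normr_gt0. Qed.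

HB.instance Definition _ := isDotProduct.Build R rkhs rkhs_dot dot_gt0.

Definition rkhs_hilbert : hilbertSpace R := @HilbertSpace R rkhs rkhs_dot dot_norm.

End Form.
End Rkhs.

(** * Powers of the lazy walk *)

Section HasSumFubini.
Context {R : realType} {I J : choiceType}.

Lemma has_sum_pair (f : I -> J -> R) (g : I -> R) s : (forall i j, 0 <= f i j) ->
  (forall i, has_sum (f i) (g i)) -> has_sum g s ->
  has_sum (fun p : I * J => f p.1 p.2) s.
Proof.
move=> f0 fg gs; apply/has_sum_esum => //.
have g0 i : 0 <= g i by exact: has_sum_ge0 (fg i).
rewrite -((has_sum_esum s g0).1 gs).
under [RHS]eq_esum => i _ do rewrite -((has_sum_esum _ (f0 i)).1 (fg i)).
rewrite (esum_esum (a := fun i j => (f i j)%:E)); last by move=> *; rewrite lee_fin.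
by congr esum; apply/seteqP; split.
Qed.

Lemma has_sum_reindex (h : I -> J) (f : J -> R) s : bijective h ->
  (forall j, 0 <= f j) -> has_sum f s -> has_sum (f \o h) s.
Proof.
move=> hbij f0 fs; apply/has_sum_esum => [i|]; first exact: f0.
rewrite -((has_sum_esum s f0).1 fs); apply/esym.
apply: (@reindex_esum R I J setT setT h (fun j => (f j)%:E)).
by rewrite setTT_bijective.
Qed.

End HasSumFubini.

Lemma has_sum_exchange (R : realType) (I J : choiceType) (f : I -> J -> R) g h s :
  (forall i j, 0 <= f i j) ->
  (forall i, has_sum (f i) (g i)) -> has_sum g s ->
  (forall j, has_sum (f ^~ j) (h j)) -> has_sum h s.
Proof.
move=> f0 fg gs fh.
have h0 j : 0 <= h j by exact: has_sum_ge0 (fh j).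
have sw : has_sum (fun p : J * I => f p.2 p.1) s.
  apply: (@has_sum_reindex _ _ _ (fun p : J * I => (p.2, p.1)) (fun p : I * J => f p.1 p.2)).
  - by exists (fun p => (p.2, p.1)) => -[].
  - by move=> p; exact: f0.
  - exact: has_sum_pair fg gs.
apply/has_sum_esum => //.
under eq_esum => j _ do rewrite -((has_sum_esum _ (fun i => f0 i j)).1 (fh j)).
rewrite (esum_esum (a := fun j i => (f i j)%:E)); last by move=> *; rewrite lee_fin.
rewrite -((has_sum_esum s (fun p : J * I => f0 p.2 p.1)).1 sw).
by congr esum; apply/seteqP; split.
Qed.

Lemma has_sum_delta (R : realType) (I : choiceType) (x : I) (f : I -> R) :
  has_sum (fun z => (x == z)%:R * f z) (f x).
Proof.
apply/has_sumP => e e0; exists [fset x]%fset => J xJ.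
rewrite (sum_fsubsetD _ xJ) big_seq_fset1 eqxx mul1r big1_seq ?addr0 ?subrr ?normr0 ?ltW//.
by move=> i /andP[_]; rewrite !inE => /andP[+ _]; rewrite eq_sym => /negbTE ->; rewrite mul0r.
Qed.

Lemma sum_sqr (R : realType) (A : Type) (t : seq (R * A)) (G : A -> R) :
  \sum_(a <- t) \sum_(b <- t) a.1 * b.1 * (G a.2 * G b.2) = (\sum_(a <- t) a.1 * G a.2) ^+ 2.
Proof.
rewrite expr2 big_distrlr /=; apply: eq_bigr => a _; apply: eq_bigr => b _.
by rewrite mulrACA.
Qed.

(** * Transition probabilities of the lazy walk and their quadratic forms *)

Section LazyWalk.
Context {R : realType} {V : countType}.
Variable P : V -> V -> R.

Definition lazy x y : R := ((x == y)%:R + P x y) / 2.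

(** [fine] makes the recursion total; that the sums are finite, so that no default value enters, is
    the content of [lazynS]. *)
Fixpoint lazyn n x y : R :=
  if n is m.+1 then fine (\esum_(z in [set: V]) (lazy x z * lazyn m z y)%:E)
  else (x == y)%:R.

Lemma lazyn0 x y : lazyn 0 x y = (x == y)%:R.
Proof. by []. Qed.

Hypothesis P_stochastic : stochastic P.
Hypothesis P_symmetric : forall x y, P x y = P y x.

Let P_ge0 x y : 0 <= P x y. Proof. exact: P_stochastic.1. Qed.

Lemma has_sum_P x : has_sum (P x) 1.
Proof. by apply/has_sum_esum => //; exact: P_stochastic.2. Qed.

Lemma lazy_ge0 x y : 0 <= lazy x y.
Proof. by rewrite divr_ge0// addr_ge0. Qed.

Lemma lazyC x y : lazy x y = lazy y x.
Proof. by rewrite /lazy eq_sym P_symmetric. Qed.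

Lemma has_sum_lazy x : has_sum (lazy x) 1.
Proof.
have := has_sumZ (2^-1) (has_sumD (has_sum_delta x (fun=> 1)) (has_sum_P x)).
have -> : 2^-1 * (1 + 1) = 1 :> R by lra.
by apply: eq_has_sum => z; rewrite /lazy mulr1 mulrC.
Qed.

(** Convergence at [n.+1] needs the bounds at [n]; this is the inductive step that makes [lazyn_01]
    and then [lazynS] available. *)
Lemma lazyn_has_sum_ex n : (forall x y, 0 <= lazyn n x y <= 1) ->
  forall x y, has_sum (fun z => lazy x z * lazyn n z y) (lazyn n.+1 x y).
Proof.
move=> U01 x y; have f0 z : 0 <= lazy x z * lazyn n z y.
  by rewrite mulr_ge0 ?lazy_ge0//; case/andP: (U01 z y).
have [z|s Hs] := @has_sum_dom R V (fun z => lazy x z * lazyn n z y) (lazy x) 1 _ (has_sum_lazy x).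
  by rewrite f0/= ler_piMr ?lazy_ge0//; case/andP: (U01 z y).
by rewrite /= ((has_sum_esum s f0).1 Hs).
Qed.

Lemma lazyn_01 n x y : 0 <= lazyn n x y <= 1.
Proof.
elim: n x y => [|n IH] x y; first by rewrite /=; case: eqP; rewrite ?lexx ?ler01.
have H := lazyn_has_sum_ex IH x y; apply/andP; split.
  by apply: has_sum_ge0 H => z; rewrite mulr_ge0 ?lazy_ge0//; case/andP: (IH z y).
apply: has_sum_le H (has_sum_lazy x) => z.
by rewrite ler_piMr ?lazy_ge0//; case/andP: (IH z y).
Qed.

Lemma lazyn_ge0 n x y : 0 <= lazyn n x y. Proof. by case/andP: (lazyn_01 n x y). Qed.

Lemma lazynS n x y : has_sum (fun z => lazy x z * lazyn n z y) (lazyn n.+1 x y).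
Proof. exact/lazyn_has_sum_ex/lazyn_01. Qed.

Lemma lazyn1 x y : lazyn 1 x y = lazy x y.
Proof.
apply: has_sum_unique (lazynS 0 x y) _; apply: eq_has_sum (has_sum_delta y (lazy x)) => z.
by rewrite /= mulrC eq_sym.
Qed.

Lemma lazynD m n x y : has_sum (fun z => lazyn m x z * lazyn n z y) (lazyn (m + n) x y).
Proof.
elim: m x y => [|m IH] x y; first exact: has_sum_delta.
apply: (@has_sum_exchange _ _ _ (fun w z => lazy x w * (lazyn m w z * lazyn n z y))
  (fun w => lazy x w * lazyn (m + n) w y)).
- by move=> w z; apply: mulr_ge0; [exact: lazy_ge0|apply: mulr_ge0; exact: lazyn_ge0].
- by move=> w; apply: has_sumZ; exact: IH.
- exact: lazynS.
- move=> z; rewrite [lazyn m.+1 x z * _]mulrC.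
  by apply: eq_has_sum (has_sumZ (lazyn n z y) (lazynS m x z)) => w; rewrite mulrC mulrA.
Qed.

Lemma lazynC n x y : lazyn n x y = lazyn n y x.
Proof.
elim: n x y => [|n IH] x y; first by rewrite /= eq_sym.
have := lazynD n 1 y x; rewrite addn1; apply: has_sum_unique.
by apply: eq_has_sum (lazynS n x y) => z; rewrite lazyn1 lazyC mulrC IH.
Qed.

Lemma has_sum_lazyn n x : has_sum (lazyn n x) 1.
Proof.
elim: n x => [|n IH] x.
  by apply: eq_has_sum (has_sum_delta x (fun=> 1)) => z; rewrite mulr1.
apply: (@has_sum_exchange _ _ _ (fun w z => lazy x w * lazyn n w z) (fun w => lazy x w * 1)).
- by move=> w z; rewrite mulr_ge0 ?lazy_ge0 ?lazyn_ge0.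
- by move=> w; apply: has_sumZ; exact: IH.
- by apply: eq_has_sum (has_sum_lazy x) => w; rewrite mulr1.
- exact: lazynS.
Qed.

Lemma lazyn_aut (g : V -> V) : bijective g -> (forall x y, P (g x) (g y) = P x y) ->
  forall n x y, lazyn n (g x) (g y) = lazyn n x y.
Proof.
move=> gbij gP; elim=> [|n IH] x y; first by rewrite /= (inj_eq (bij_inj gbij)).
have := lazynS n x y; apply: has_sum_unique.
have := @has_sum_reindex _ _ _ g _ _ gbij _ (lazynS n (g x) (g y)).
move=> /(_ (fun z => mulr_ge0 (lazy_ge0 _ _) (lazyn_ge0 _ _ _))).
by apply: eq_has_sum => z /=; rewrite IH /lazy gP (inj_eq (bij_inj gbij)).
Qed.

Lemma has_sum_P_lazyn n x y : has_sum (fun z => P x z * lazyn n z y) (2 * lazyn n.+1 x y - lazyn n x y).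
Proof.
have := has_sumB (has_sumZ (2) (lazynS n x y)) (has_sum_delta x (lazyn n ^~ y)).
by apply: eq_has_sum => z; rewrite /lazy; lra.
Qed.

Opaque lazyn.

(** With [f] the sum over [a] in [t] of [a.1 T^(a.2.1) 1_(a.2.2)], this is the inner product of
    [T^n f] and [f] in l^2. *)
Definition lazyn_form n (t : seq (R * (nat * V))) : R :=
  \sum_(a <- t) \sum_(b <- t) a.1 * b.1 * lazyn (a.2.1 + b.2.1 + n) a.2.2 b.2.2.

Lemma lazyn_form0_ge0 t : 0 <= lazyn_form 0 t.
Proof.
pose F (a : nat * V) z := lazyn a.1 a.2 z.
have : has_sum (fun z => \sum_(a <- t) \sum_(b <- t) a.1 * b.1 * (F a.2 z * F b.2 z)) (lazyn_form 0 t).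
  apply: has_sum_sum => a; apply: has_sum_sum => b; apply: has_sumZ.
  rewrite addn0; apply: eq_has_sum (lazynD a.2.1 b.2.1 a.2.2 b.2.2) => z.
  by rewrite /F (lazynC b.2.1).
apply: has_sum_ge0 => z.
by rewrite (sum_sqr t (F ^~ z)) sqr_ge0.
Qed.

(* Expanding [P z w * (f z + e * f w) ^+ 2] and summing over all pairs (z, w), for
   e = 1 or e = -1, bounds the quadratic form of P by the l^2 norm of f. *)
Lemma dirichlet_ge0 e t : e ^+ 2 = 1 -> 0 <= (1 - e) * lazyn_form 0 t + 2 * e * lazyn_form 1 t.
Proof.
move=> e2; pose F (a : nat * V) z := lazyn a.1 a.2 z.
pose S (a b : nat * V) := lazyn (a.1 + b.1) a.2 b.2.
pose S' (a b : nat * V) := 2 * lazyn (a.1 + b.1 + 1) a.2 b.2 - lazyn (a.1 + b.1) a.2 b.2.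
have swb : bijective (fun p : V * V => (p.2, p.1)) by exists (fun p => (p.2, p.1)) => -[].
have FF a b : has_sum (fun z => F a z * F b z) (S a b).
  by apply: eq_has_sum (lazynD a.1 b.1 a.2 b.2) => z; rewrite /F (lazynC b.1).
have h11 a b : has_sum (fun p : V * V => P p.1 p.2 * (F a p.1 * F b p.1)) (S a b).
  apply: (@has_sum_pair _ _ _ (fun z w => P z w * (F a z * F b z)) (fun z => F a z * F b z)) => //.
  - by move=> z w; rewrite !mulr_ge0 ?lazyn_ge0.
  - move=> z; have := has_sumZ (F a z * F b z) (has_sum_P z); rewrite mulr1.
    by apply: eq_has_sum => w; rewrite mulrC.
have h22 a b : has_sum (fun p : V * V => P p.1 p.2 * (F a p.2 * F b p.2)) (S a b).
  have := has_sum_reindex swb _ (h11 a b).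
  move=> /(_ (fun p => mulr_ge0 (P_ge0 _ _) (mulr_ge0 (lazyn_ge0 _ _ _) (lazyn_ge0 _ _ _)))).
  by apply: eq_has_sum => p /=; rewrite P_symmetric.
have h12 a b : has_sum (fun p : V * V => P p.1 p.2 * (F a p.1 * F b p.2)) (S' a b).
  apply: (@has_sum_pair _ _ _ (fun z w => P z w * (F a z * F b w))
    (fun z => F a z * (2 * lazyn b.1.+1 z b.2 - lazyn b.1 z b.2))).
  - by move=> z w; rewrite !mulr_ge0 ?lazyn_ge0.
  - move=> z; have := has_sumZ (F a z) (has_sum_P_lazyn b.1 z b.2).
    by apply: eq_has_sum => w; rewrite /F (lazynC b.1 w) mulrCA.
  - have := has_sumB (has_sumZ (2) (lazynD a.1 b.1.+1 a.2 b.2)) (lazynD a.1 b.1 a.2 b.2).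
    rewrite /S' addnS addn1; apply: eq_has_sum => z; rewrite /F.
    by rewrite mulrBr mulrCA.
have h21 a b : has_sum (fun p : V * V => P p.1 p.2 * (F a p.2 * F b p.1)) (S' a b).
  have := h12 b a; have -> : S' b a = S' a b.
    by rewrite /S' (addnC b.1) (lazynC _ b.2) (lazynC (_ + _) b.2).
  by apply: eq_has_sum => p; rewrite (mulrC (F b _)).
have : has_sum (fun p : V * V => \sum_(a <- t) \sum_(b <- t) a.1 * b.1 *
   (P p.1 p.2 * ((F a.2 p.1 + e * F a.2 p.2) * (F b.2 p.1 + e * F b.2 p.2))))
   (\sum_(a <- t) \sum_(b <- t) a.1 * b.1 * (2 * S a.2 b.2 + e * (2 * S' a.2 b.2))).
  apply: has_sum_sum => a; apply: has_sum_sum => b; apply: has_sumZ.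
  have := has_sumD (has_sumD (h11 a.2 b.2) (has_sumZ (e ^+ 2) (h22 a.2 b.2)))
    (has_sumZ (e) (has_sumD (h12 a.2 b.2) (h21 a.2 b.2))).
  rewrite (_ : S a.2 b.2 + _ + _ = 2 * S a.2 b.2 + e * (2 * S' a.2 b.2)); last first.
    by rewrite e2; move: (S _ _) (S' _ _) => u v; lra.
  apply: eq_has_sum => p; move: (F a.2 _) (F a.2 _) (F b.2 _) (F b.2 _) (P _ _) => u v w z c.
  lra.
move=> /has_sum_ge0 H.
have {}H : 0 <= \sum_(a <- t) \sum_(b <- t) a.1 * b.1 * (2 * S a.2 b.2 + e * (2 * S' a.2 b.2)).
  apply: H => p.
  rewrite (eq_bigr (fun a => \sum_(b <- t) P p.1 p.2 * (a.1 * b.1 *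
     ((F a.2 p.1 + e * F a.2 p.2) * (F b.2 p.1 + e * F b.2 p.2))))); last first.
    by move=> a _; apply: eq_bigr => b _; rewrite mulrCA.
  under eq_bigr do rewrite -mulr_sumr.
  rewrite -mulr_sumr (sum_sqr t (fun a => F a p.1 + e * F a p.2)).
  by rewrite mulr_ge0// sqr_ge0.
move: H; have -> : \sum_(a <- t) \sum_(b <- t) a.1 * b.1 * (2 * S a.2 b.2 + e * (2 * S' a.2 b.2)) =
    2 * ((1 - e) * lazyn_form 0 t + 2 * e * lazyn_form 1 t).
  rewrite /lazyn_form !mulr_sumr -big_split /= mulr_sumr; apply: eq_bigr => a _.
  rewrite !mulr_sumr -big_split /= mulr_sumr; apply: eq_bigr => b _.
  by rewrite /S /S' addn0; move: (lazyn _ _ _) (lazyn _ _ _) => u v; lra.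
by rewrite pmulr_rge0.
Qed.

(** The case [e = 1]: as [P >= -1] as an operator, [T = (1 + P) / 2] is positive. This is what
    laziness is for. *)
Lemma lazyn_form1_ge0 t : 0 <= lazyn_form 1 t.
Proof. have := @dirichlet_ge0 1 t; rewrite expr1n => /(_ erefl); lra. Qed.

(** The case [e = -1], that is, [T <= 1] as an operator. *)
Lemma lazyn_form1_le t : lazyn_form 1 t <= lazyn_form 0 t.
Proof. have := @dirichlet_ge0 (-1) t; rewrite sqrrN expr1n => /(_ erefl); lra. Qed.

End LazyWalk.

Arguments lazyn {R V} P n x y : simpl never.
Global Opaque lazyn.

(** * Walks in the graph and the kernels of the lazy walk *)

Lemma is_walkS (V : eqType) (E : rel V) x y n : is_walk E x y n.+1 ->
  exists z, E x z /\ is_walk E z y n.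
Proof.
move=> [[|z p] [//= /andP[xz zp] py [pn]]].
by exists z; split=> //; exists p.
Qed.

Lemma is_walk0 (V : eqType) (E : rel V) x y : is_walk E x y 0 -> x = y.
Proof. by move=> [[|z p] [//= _ -> _]]. Qed.

Lemma graph_dist_walk (V : eqType) (E : rel V) x y : connected_graph E ->
  is_walk E x y (graph_dist E x y).
Proof.
move=> /(_ x y)[n xyn]; rewrite /graph_dist; case: pselect => [h|[]]; last first.
  by exists n; apply/asboolP.
by case: ex_minnP => m /asboolP.
Qed.

Lemma graph_dist_min (V : eqType) (E : rel V) x y n : is_walk E x y n ->
  (graph_dist E x y <= n)%N.
Proof.
move=> xyn; rewrite /graph_dist; case: pselect => [h|[]]; last first.
  by exists n; apply/asboolP.
by case: ex_minnP => m _; apply; apply/asboolP.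
Qed.

Lemma graph_dist_triangle (V : eqType) (E : rel V) x y z : connected_graph E ->
  (graph_dist E x z <= graph_dist E x y + graph_dist E y z)%N.
Proof.
move=> Ec; have [p [xp py ps]] := graph_dist_walk x y Ec.
have [q [yq qz qs]] := graph_dist_walk y z Ec.
apply: graph_dist_min; exists (p ++ q).
by rewrite cat_path xp py yq last_cat py qz size_cat ps qs.
Qed.

Lemma is_walk_sym (V : eqType) (E : rel V) x y n : symmetric E ->
  is_walk E x y n -> is_walk E y x n.
Proof.
move=> Es [p [xp py ps]]; exists (rev (belast x p)); split.
- by rewrite -py rev_path (eq_path (e' := E))// => u v; exact: Es.
- case: p xp py ps => [|z p]/= _ py _; first exact/esym.
  by rewrite rev_cons last_rcons.
- by rewrite size_rev size_belast.
Qed.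

Lemma graph_dist_sym (V : eqType) (E : rel V) x y : symmetric E ->
  connected_graph E -> graph_dist E x y = graph_dist E y x.
Proof.
move=> Es Ec; apply/eqP; rewrite eqn_leq.
by rewrite !graph_dist_min//; apply: is_walk_sym => //; exact: graph_dist_walk.
Qed.

(** * Quadratic growth of kernel distances along walks *)

Section PsdDistance.
Context {R : realType} {V : eqType}.
Variables (K : V -> V -> R) (c : R).
Hypotheses (K_sym : forall x y, K x y = K y x) (K_diag : forall x, K x x = c)
  (K_psd : forall t : seq (R * V), 0 <= \sum_(a <- t) \sum_(b <- t) a.1 * b.1 * K a.2 b.2).

Lemma psd_le_diag x y : K x y <= c.
Proof.
have := K_psd [:: (1, x); (-1, y)].
rewrite !big_cons !big_nil /= !K_diag (K_sym y x); lra.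
Qed.

(* If K is the Gram kernel of f, then 2 (c - K x y) = |f x - f y|^2; the bound is the
   triangle inequality along the walk. *)
Lemma psd_walk (E : rel V) A : (forall x y, E x y -> c - K x y <= A) ->
  forall n x y, is_walk E x y n -> c - K x y <= n%:R ^+ 2 * A.
Proof.
move=> EA; elim=> [|n IH] x y.
  by move=> /is_walk0 ->; rewrite K_diag subrr expr0n mul0r.
move=> /is_walkS[z [xz zy]]; have := IH _ _ zy; have := EA _ _ xz.
case: n IH zy => [|n] IH zy; first by rewrite (is_walk0 zy) expr1n mul1r.
(* With [N = n.+1], [a = f x - f z] and [b = f z - f y] this is [|N a - b|^2 >= 0]. The weight [N]
   balances the bounds on [|a|] and [|b|], which are in ratio [1 : N], so that the constant is
   exactly [(N + 1)^2]. *)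
have := K_psd [:: (n.+1%:R, x); (- n.+2%:R, z); (1, y)].
rewrite !big_cons !big_nil /= !K_diag (K_sym z x) (K_sym y x) (K_sym y z).
rewrite -[n.+2%:R]natr1; have := ler0n R n; rewrite -[n.+1%:R]natr1.
move: (n%:R) (K x y) (K x z) (K z y) => m u v w m0 h vA wA.
have m1 : 0 < m + 1 by lra.
rewrite -(ler_pM2l m1).
have := ler_wpM2l (ltW (mulr_gt0 m1 (ltr_wpDl (ltW m1) ltr01))) vA.
have m2 : 0 <= m + 1 + 1 by lra.
have := ler_wpM2l m2 wA.
nra.
Qed.

End PsdDistance.

(** * Kernels of [T^(2k)] and [T^(2k) (1 - T)], and their energies *)

Section LazyWalkKernels.
Context {R : realType} {V : countType}.
Variable P : V -> V -> R.
Hypothesis P_stochastic : stochastic P.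
Hypothesis P_symmetric : forall x y, P x y = P y x.
Variable p : nat -> R.
Hypothesis lazyn_diag : forall n x, lazyn P n x x = p n.

Local Notation U := (lazyn P).

Definition decr n : R := p n - p n.+1.

Lemma lazyn_psd k (t : seq (R * V)) :
  0 <= \sum_(a <- t) \sum_(b <- t) a.1 * b.1 * U k.*2 a.2 b.2.
Proof.
have := lazyn_form0_ge0 P_stochastic P_symmetric [seq (a.1, (k, a.2)) | a <- t].
rewrite /lazyn_form big_map; under eq_bigr do rewrite big_map.
by under eq_bigr do under eq_bigr do rewrite /= addn0 addnn.
Qed.

(** The kernel of [T^(2k) (1 - T)], positive semidefinite because [T <= 1]. It measures how far
    [T^k 1_x] is from being harmonic in [x]. *)
Definition decr_ker k x y : R := U k.*2 x y - U k.*2.+1 x y.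

Lemma decr_ker_psd k (t : seq (R * V)) :
  0 <= \sum_(a <- t) \sum_(b <- t) a.1 * b.1 * decr_ker k a.2 b.2.
Proof.
have := lazyn_form1_le P_stochastic P_symmetric [seq (a.1, (k, a.2)) | a <- t].
rewrite -subr_ge0 /lazyn_form !big_map -sumrB; under eq_bigr do rewrite !big_map -sumrB.
by under eq_bigr do under eq_bigr do rewrite -mulrBr /= addn0 addn1 addnn.
Qed.

Lemma decr_ker_diag k x : decr_ker k x x = decr k.*2.
Proof. by rewrite /decr_ker !lazyn_diag. Qed.

Lemma decr_ker_sym k x y : decr_ker k x y = decr_ker k y x.
Proof. by rewrite /decr_ker !(lazynC P_stochastic P_symmetric _ x). Qed.

Lemma lazyn_le_diag k x y : U k.*2 x y <= p k.*2.
Proof.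
by apply: (psd_le_diag (lazynC P_stochastic P_symmetric _) (lazyn_diag _) (lazyn_psd k)).
Qed.

Lemma decr_ker_le_diag k x y : decr_ker k x y <= decr k.*2.
Proof. by apply: (psd_le_diag (decr_ker_sym k) (decr_ker_diag k) (decr_ker_psd k)). Qed.

Hypothesis V_inhab : V.

Lemma decr_even_ge0 k : 0 <= decr k.*2.
Proof.
have := decr_ker_psd k [:: (1, V_inhab)].
by rewrite !big_seq1 /= decr_ker_diag !mul1r.
Qed.

(** The difference is [|f|^2] for [f = T^k 1_x - T^(k+1) 1_x]. *)
Lemma decr_odd_le k : decr k.*2.+1 <= decr k.*2.
Proof.
have := lazyn_form0_ge0 P_stochastic P_symmetric [:: (1, (k, V_inhab)); (-1, (k.+1, V_inhab))].
rewrite /lazyn_form !big_cons !big_nil /= !lazyn_diag !(addnS, addSn, addn0, addnn) /decr; lra.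
Qed.

(** With the same [f], the difference is the inner product of [T f] and [f]. *)
Lemma decr_even_le k : decr k.+1.*2 <= decr k.*2.+1.
Proof.
have := lazyn_form1_ge0 P_stochastic P_symmetric [:: (1, (k, V_inhab)); (-1, (k.+1, V_inhab))].
rewrite /lazyn_form !big_cons !big_nil /= !lazyn_diag !(addnS, addSn, addn0, addnn) /decr.
rewrite doubleS; lra.
Qed.

(** The sum is the diagonal entry of [(1 - P) T^(2k)], and [1 - P = 2 (1 - T)]. *)
Lemma has_sum_energy k x : has_sum (fun z => P x z * (p k.*2 - U k.*2 x z)) (2 * decr k.*2).
Proof.
have := has_sumB (has_sumZ (p k.*2) (has_sum_P P_stochastic x)) (has_sum_P_lazyn P_stochastic k.*2 x x).
rewrite !lazyn_diag mulr1.
have -> : p k.*2 - (2 * p k.*2.+1 - p k.*2) = 2 * decr k.*2 by rewrite /decr; lra.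
apply: eq_has_sum => z; rewrite (lazynC P_stochastic P_symmetric _ z); lra.
Qed.

Lemma has_sum_P_decr_ker k x y : has_sum (fun z => P x z * decr_ker k z y)
  (2 * U k.*2.+1 x y - U k.*2 x y - (2 * U k.*2.+2 x y - U k.*2.+1 x y)).
Proof.
have := has_sumB (has_sum_P_lazyn P_stochastic k.*2 x y) (has_sum_P_lazyn P_stochastic k.*2.+1 x y).
by apply: eq_has_sum => z; rewrite -mulrBr.
Qed.

Lemma has_sum_decr_ker_energy k x :
  has_sum (fun z => P x z * (decr k.*2 - decr_ker k x z)) (2 * (decr k.*2 - decr k.*2.+1)).
Proof.
have := has_sumB (has_sumZ (decr k.*2) (has_sum_P P_stochastic x)) (has_sum_P_decr_ker k x x).
rewrite !lazyn_diag mulr1.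
have -> : decr k.*2 - (2 * p k.*2.+1 - p k.*2 - (2 * p k.*2.+2 - p k.*2.+1)) =
  2 * (decr k.*2 - decr k.*2.+1) by rewrite /decr; lra.
apply: eq_has_sum => z; rewrite (decr_ker_sym _ z); lra.
Qed.

Variables (E : rel V) (pstar : R).
Hypotheses (E_connected : connected_graph E) (pstar_gt0 : 0 < pstar)
  (pstar_le : forall x y, E x y -> pstar <= P x y).

Let P_ge0 x y : 0 <= P x y. Proof. exact: P_stochastic.1. Qed.

(** On an edge, one term of the energy is at most the whole and has weight at least [pstar];
    [psd_walk] extends the bound along a shortest walk. *)
Lemma lazyn_dist k x y :
  p k.*2 - U k.*2 x y <= (graph_dist E x y)%:R ^+ 2 * (2 * decr k.*2 / pstar).
Proof.
apply: (psd_walk (lazynC P_stochastic P_symmetric _) (lazyn_diag _) (lazyn_psd k) (E := E)).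
  move=> {}x {}y xy; rewrite ler_pdivlMr// mulrC.
  apply: le_trans (has_sum_ge_term y _ (has_sum_energy k x)).
    by apply: ler_wpM2r; [rewrite subr_ge0 lazyn_le_diag|exact: pstar_le].
  by move=> z; rewrite mulr_ge0// subr_ge0 lazyn_le_diag.
exact: graph_dist_walk.
Qed.

Lemma decr_ker_dist k x y : decr k.*2 - decr_ker k x y <=
  (graph_dist E x y)%:R ^+ 2 * (2 * (decr k.*2 - decr k.*2.+1) / pstar).
Proof.
apply: (psd_walk (decr_ker_sym k) (decr_ker_diag k) (decr_ker_psd k) (E := E)).
  move=> {}x {}y xy; rewrite ler_pdivlMr// mulrC.
  apply: le_trans (has_sum_ge_term y _ (has_sum_decr_ker_energy k x)).
    by apply: ler_wpM2r; [rewrite subr_ge0 decr_ker_le_diag|exact: pstar_le].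
  by move=> z; rewrite mulr_ge0// subr_ge0 decr_ker_le_diag.
exact: graph_dist_walk.
Qed.

End LazyWalkKernels.

(** * Haar measure and mass transport *)

Lemma filter_ex2 (T : Type) (F : set_system T) {FF : ProperFilter F} (A B : set T) :
  F A -> F B -> exists t, A t /\ B t.
Proof. by move=> FA FB; have [t [At Bt]] := filter_ex (filterI FA FB); exists t. Qed.

Lemma ultra_finite (T : Type) (U : choiceType) (F : set_system T) (FF : UltraFilter F) (phi : T -> U)
    (S : set U) : finite_set S -> F (phi @^-1` S) -> exists u, F [set t | phi t = u].
Proof.
move=> Sfin FS; apply: contrapT => /forallNP H.
have Hn u : F [set t | phi t <> u].
  by case: (in_ultra_setVsetC [set t | phi t = u] FF) => // /H.
have : F (\bigcap_(u in S) [set t | phi t <> u]).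
  by have /finite_fsetP[D ->] := Sfin; apply: filter_bigI => u _; exact: Hn.
by move=> /(filterI FS)/filter_ex[t [St /(_ _ St)]].
Qed.

Section Action.
Context {R : realType} {V : countType} {P : V -> V -> R} {Gamma : groupClosed (AutP P)}.

Notation G := (subgroup Gamma).

Definition act (s : G) (x : V) : V := aut_fun (val s) x.

Lemma actM s t x : act (s * t)%g x = act s (act t x). Proof. by []. Qed.

Lemma actK s : cancel (act s) (act s^-1%g).
Proof. by move=> x; rewrite -actM mulVg. Qed.

Lemma actVK s : cancel (act s^-1%g) (act s).
Proof. by move=> x; rewrite -actM mulgV. Qed.

Lemma act_bij s : bijective (act s).
Proof. by exists (act s^-1%g); [exact: actK|exact: actVK]. Qed.

Lemma act_P s x y : P (act s x) (act s y) = P x y.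
Proof. by have [_ ->] := set_mem (valP (val s)). Qed.

Lemma near_act s x : \forall t \near s, act t x = act s x.
Proof.
have := @initial_continuous G (AutP P) val s.
by move=> /(_ _ (near_aut (val s) x)).
Qed.

Lemma near_actV s x : \forall t \near s, act t^-1%g x = act s^-1%g x.
Proof. by have := @invg_continuous G s _ (near_act s^-1%g x). Qed.

Lemma loc_cst_open (T : Type) (phi : G -> T) (B : set T) :
  (forall s, \forall t \near s, phi t = phi s) -> open (phi @^-1` B).
Proof.
move=> phi_loc; rewrite openE => s Bs; apply: filterS (phi_loc s) => t /= ts.
by rewrite /preimage /= ts.
Qed.

Lemma open_measurable_borel (U : set G) : open U -> measurable (U : set (borel G)).
Proof. by move=> oU; apply: sub_sigma_algebra. Qed.

Definition transporter x y : set G := [set s | act s x = y].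

Lemma open_transporter x y : open (transporter x y).
Proof. by apply: (@loc_cst_open V (act ^~ x) [set y]) => s; exact: near_act. Qed.

Lemma transporter_translate g x y :
  [set (g * s)%g | s in transporter x y] = transporter x (act g y).
Proof.
apply/seteqP; split=> [_ [s <- <-]//|s sx]; exists (g^-1 * s)%g; last by rewrite mulgA mulgV mul1g.
by rewrite /transporter /= actM sx actK.
Qed.

Lemma transporter_translater g x y :
  [set (s * g)%g | s in transporter x y] = transporter (act g^-1%g x) y.
Proof.
apply/seteqP; split=> [_ [s <- <-]|s sx].
  by rewrite /transporter /= actM actVK.
by exists (s * g^-1)%g; [rewrite /transporter /= actM|rewrite -mulgA mulVg mulg1].
Qed.

Hypothesis Gamma_closed : closed [set g : AutP P | g \in Gamma].

(** Finite orbits force every ultrafilter on the stabilizer to converge pointwise. The limit of the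
    inverses makes the limit map bijective, and closedness keeps it in [Gamma]. *)
Lemma stab_compact (o : V) :
  (forall x, finite_set [set act s x | s in transporter o o]) ->
  compact (transporter o o).
Proof.
move=> orb_fin; rewrite compact_ultra => F FF Fo.
have Fs x : exists y, F [set t | act t x = y].
  apply: (ultra_finite FF (orb_fin x)); apply: filterS Fo => t ot /=.
  by exists t.
(* The stabilizer is closed under inverses, so [act t^-1%g x] ranges over the same finite orbit. *)
have Fs' x : exists y, F [set t : G | act t^-1%g x = y].
  apply: (ultra_finite FF (orb_fin x)); apply: filterS Fo => t ot /=.
  by exists t^-1%g => //; rewrite /transporter /= -{1}ot actK.
pose s x := projT1 (cid (Fs x)); pose s' x := projT1 (cid (Fs' x)).
have sP x : F [set t | act t x = s x] := projT2 (cid (Fs x)).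
have s'P x : F [set t : G | act t^-1%g x = s' x] := projT2 (cid (Fs' x)).
have s_aut : is_aut P s.
  split.
    exists s' => x.
      by have [t [/= tx <-]] := filter_ex2 (sP x) (s'P (s x)); rewrite -tx actK.
    by have [t [/= tx <-]] := filter_ex2 (s'P x) (sP (s' x)); rewrite -tx actVK.
  move=> x y; have [t [/= <- <-]] := filter_ex2 (sP x) (sP y).
  exact: act_P.
pose g := mk_aut s_aut.
have Fg : (fun t : G => val t) @ F --> (g : AutP P).
  by apply/cvg_autP => x; exact: sP.
have gG : g \in Gamma.
  apply: (@closed_cvg _ _ F _ (fun t : G => val t) (fun h : AutP P => h \in Gamma) Gamma_closed _ g Fg).
  by apply: filterE => t; exact: valP.
pose h : G := Sub g gG.
exists h; split.
  have [t [/= + to]] := filter_ex2 (sP o) Fo.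
  by move=> so; change (s o = o); rewrite -so.
move=> A [_ [[B oB <-] Bs] /filterS]; apply.
by apply: Fg; apply: open_nbhs_nbhs; split.
Qed.

(** * Measures of transporters and the mass transport principle *)

Section HaarTransport.
Variable mu : {measure set (borel G) -> \bar R}.
Hypotheses (mu_left : left_haar mu) (mu_right : right_invariant mu).
Hypothesis transitive : forall x y, exists g : G, act g x = y.
Variable o : V.
Hypothesis orb_fin : forall x, finite_set [set act s x | s in transporter o o].

(** Left translation moves the target and right translation the source; here unimodularity
    enters. *)
Lemma transporter_measure x y : mu (transporter x y) = mu (transporter o o).
Proof.
have m u v : measurable (transporter u v : set (borel G)).
  by apply: open_measurable_borel; exact: open_transporter.
have [g gy] := transitive y o; have [h hx] := transitive o x.
have [_ linv _] := mu_left.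
rewrite -(linv g _ (m x y)) transporter_translate gy.
by rewrite -(mu_right h (m x o)) transporter_translater -hx actK.
Qed.

Lemma has_sum_partition (B : set (borel G)) (phi : G -> V) :
  (forall s, \forall t \near s, phi t = phi s) -> measurable B -> (mu B < +oo)%E ->
  has_sum (fun y => fine (mu (B `&` phi @^-1` [set y]))) (fine (mu B)).
Proof.
move=> phi_loc mB Bfin.
have mphi S : measurable (phi @^-1` S : set (borel G)).
  by apply: open_measurable_borel; exact: loc_cst_open.
have mBy S : measurable (B `&` (phi @^-1` S : set (borel G))) by exact: measurableI.
have fin S : (mu (B `&` phi @^-1` S) < +oo)%E.
  by apply: le_lt_trans Bfin; apply: le_measure; rewrite ?inE.
apply/has_sum_esum => [y|]; first exact: fine_ge0.
have finE S : (fine (mu (B `&` phi @^-1` S)))%:E = mu (B `&` phi @^-1` S).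
  by rewrite fineK// ge0_fin_numE.
rewrite fineK ?ge0_fin_numE//; under eq_esum do rewrite finE.
(* Countable additivity is indexed by [nat], so the pieces are numbered by the codes of points; a
   number that codes no point gives the empty set. *)
pose D n : set (borel G) := B `&` phi @^-1` [set y : V | choice.pickle y = n].
have mD n : measurable (D n) by exact: mBy.
have BD : B = \bigcup_n D n.
  apply/seteqP; split=> [s Bs|s [n _ []//]].
  by exists (choice.pickle (phi s)).
rewrite [in RHS]BD measure_bigcup//; last first.
  by move=> i j _ _ [s [[_ /= <-] [_ /= <-]]].
rewrite nneseries_esum//.
rewrite (eq_esum (b := fun n => if n \in range (@choice.pickle V) then mu (D n) else 0%E)); last first.
  move=> n _; case: ifPn => // nr; rewrite (_ : D n = set0) ?measure0//.
  apply/seteqP; split=> // s [_ /= sn]; case/negP: nr; apply/mem_set.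
  by exists (phi s).
rewrite (_ : [set x | x \in setT] = setT); last by apply/seteqP; split=> // x _ /=; rewrite inE.
rewrite -(esum_mkcond (range (@choice.pickle V)) (fun n => mu (D n))).
rewrite (esum_image setT (@choice.pickle V)); last by move=> x y _ _; exact: (pcan_inj choice.pickleK).
apply: eq_esum => y _; congr (mu (_ `&` _)); apply/seteqP; split=> s /=; first by move=> ->.
exact: (pcan_inj choice.pickleK).
Qed.

Definition haar_cst : R := fine (mu (transporter o o)).

Lemma stab_measure_fin : (mu (transporter o o) < +oo)%E.
Proof. by have [[+ _ _] _ _] := mu_left; apply; exact: stab_compact. Qed.

(** The group is the countable union of the sets [transporter o y], all of the same measure; were it
    zero, [mu] would vanish. *)
Lemma haar_cst_gt0 : 0 < haar_cst.
Proof.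
rewrite fine_gt0// stab_measure_fin andbT lt_neqAle measure_ge0 andbT eq_sym.
have [_ _ muT] := mu_left; apply: contra muT => /eqP mu0.
have m y : measurable (transporter o y : set (borel G)).
  by apply: open_measurable_borel; exact: open_transporter.
pose D n : set (borel G) := [set s : G | choice.pickle (act s o) = n].
have mD n : measurable (D n).
  apply: open_measurable_borel.
  by apply: (@loc_cst_open V (fun s => act s o) [set y : V | choice.pickle y = n]) => s; exact: near_act.
have TD : [set: borel G] = \bigcup_n D n.
  by apply/seteqP; split=> // s _; exists (choice.pickle (act s o)).
rewrite TD measure_bigcup//; last by move=> i j _ _ [s [/= <- /= <-]].
rewrite eseries0// => n _ _.
have [[y yn]|noy] := pselect (exists y : V, choice.pickle y = n); last first.
  rewrite (_ : D n = set0) ?measure0//; apply/seteqP; split=> // s sn.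
  by case: noy; exists (act s o).
rewrite (_ : D n = transporter o y) ?transporter_measure//.
apply/seteqP; split=> s /=; last by rewrite /D /transporter /= => ->.
by rewrite /D /= -yn => /(pcan_inj choice.pickleK).
Qed.

(** Let [m y y'] be the measure of the [s] with [s o = y] and [s y' = o]. Its rows and columns all
    sum to [haar_cst], and where it is nonzero invariance gives [F o y = F y' o]; summing
    [F o y * m y y'] in both orders yields the claim. *)
Lemma mass_transport (F : V -> V -> R) t : (forall x y, 0 <= F x y) ->
  (forall (g : G) x y, F (act g x) (act g y) = F x y) ->
  has_sum (F o) t -> has_sum (F ^~ o) t.
Proof.
move=> F0 Finv Fo; pose c := haar_cst.
pose m y y' := fine (mu (transporter o y `&` transporter y' o)).
have mt u v : measurable (transporter u v : set (borel G)).
  by apply: open_measurable_borel; exact: open_transporter.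
have tfin u v : (mu (transporter u v) < +oo)%E.
  by rewrite transporter_measure stab_measure_fin.
have mrow y : has_sum (m y) c.
  rewrite /c /haar_cst -(transporter_measure o y).
  have := @has_sum_partition (transporter o y) (fun s => act s^-1%g o) _ (mt _ _) (tfin _ _).
  move=> /(_ (fun s => near_actV s o)); apply: eq_has_sum => y'.
  rewrite /m; congr (fine (mu (_ `&` _))); apply/seteqP; split=> s /=.
    by rewrite /transporter /= => <-; rewrite actVK.
  by rewrite /transporter /= => <-; rewrite actK.
have mcol y' : has_sum (m ^~ y') c.
  rewrite /c /haar_cst -(transporter_measure y' o).
  have := @has_sum_partition (transporter y' o) (fun s => act s o) _ (mt _ _) (tfin _ _).
  move=> /(_ (fun s => near_act s o)); apply: eq_has_sum => y.
  by rewrite /m setIC.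
have : has_sum (fun y' => F y' o * c) (c * t).
  apply: (@has_sum_exchange _ _ _ (fun y y' => F o y * m y y') (fun y => F o y * c)).
  - by move=> y y'; rewrite mulr_ge0// fine_ge0.
  - by move=> y; apply: has_sumZ.
  - by apply: eq_has_sum (has_sumZ c Fo) => y; rewrite mulrC.
  - move=> y'; apply: eq_has_sum (has_sumZ (F y' o) (mcol y')) => y.
    have [me|/set0P[s [/= so sy']]] := eqVneq (transporter o y `&` transporter y' o) set0.
      by rewrite /m me measure0 /= !mulr0.
    by congr (_ * _); rewrite -(Finv s) so sy'.
have c0 : c != 0 by rewrite gt_eqF// haar_cst_gt0.
move=> /(has_sumZ c^-1); rewrite mulrA mulVf// mul1r.
by apply: eq_has_sum => y; rewrite mulrCA mulVf// mulr1.
Qed.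

End HaarTransport.
End Action.

(** * Invariant means of antisymmetric flows *)

Section Drift.
Context {R : realType} {V : countType} {P : V -> V -> R} {Gamma : groupClosed (AutP P)}.

Notation G := (subgroup Gamma).

Variable mu : {measure set (borel G) -> \bar R}.

(** Locally constant bounded functions are Borel and essentially bounded for every measure, so the
    mean can be applied to them without further measurability arguments. *)
Definition lc_bounded (f : borel G -> R) : Prop :=
  (forall s : G, \forall t \near s, f t = f s) /\ exists M, forall s, `|f s| <= M.

Lemma lc_bounded_Lfun f : lc_bounded f -> f \in Lfun mu +oo.
Proof.
move=> [f_loc [M fM]]; rewrite inE; apply/andP; split; rewrite inE /=.
  move=> _ B mB; rewrite setTI.
  by apply: open_measurable_borel; exact: loc_cst_open.
rewrite /finite_norm unlock /=; case: ifPn => // muT.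
apply: (@le_lt_trans _ _ M%:E); last exact: ltry.
by apply/ess_sup_inf.ess_supP; apply: aeW => s /=; rewrite lee_fin.
Qed.

Lemma lc_bounded_cst c : lc_bounded (cst c).
Proof. by split=> [s|]; [exact: filterE|exists `|c|]. Qed.

Lemma lc_bounded_lin a f h : lc_bounded f -> lc_bounded h -> lc_bounded (fun x => a * f x + h x).
Proof.
move=> [f_loc [M fM]] [h_loc [N hN]]; split=> [s|].
  by apply: filterS2 (f_loc s) (h_loc s) => t -> ->.
exists (`|a| * M + N) => s; apply: (le_trans (ler_normD _ _)).
by rewrite normrM lerD// ler_wpM2l.
Qed.

Variable m : (borel G -> R) -> R.
Hypothesis m_mean : left_invariant_mean mu m.

Lemma mean_lin a f h : lc_bounded f -> lc_bounded h -> m (fun x => a * f x + h x) = a * m f + m h.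
Proof. by have [_ H _ _ _] := m_mean => lf lh; apply: H; exact: lc_bounded_Lfun. Qed.

Lemma mean0 : m (cst 0) = 0.
Proof.
have := mean_lin 1 (lc_bounded_cst 0) (lc_bounded_cst 0).
have -> : (fun x : borel G => 1 * (cst 0 x : R) + cst 0 x) = cst 0.
  by apply/funext => x /=; rewrite mulr0 addr0.
lra.
Qed.

Lemma mean_cst c : m (cst c) = c.
Proof.
have [_ _ _ m1 _] := m_mean.
have := mean_lin c (lc_bounded_cst 1) (lc_bounded_cst 0).
have -> : (fun x : borel G => c * (cst 1 x : R) + cst 0 x) = cst c.
  by apply/funext => x /=; rewrite mulr1 addr0.
by move=> ->; rewrite mean0 addr0 m1 mulr1.
Qed.

Lemma mean_ge c f : lc_bounded f -> (forall s, c <= f s) -> c <= m f.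
Proof.
move=> fL cf; have [_ _ mpos _ _] := m_mean.
have := mean_lin (-1) (lc_bounded_cst c) fL; rewrite mean_cst => H.
rewrite -subr_ge0 addrC -mulN1r -H; apply: mpos.
  by apply/lc_bounded_Lfun/lc_bounded_lin => //; exact: lc_bounded_cst.
by apply: aeW => s /=; rewrite mulN1r addrC subr_ge0.
Qed.

Lemma lc_bounded_sum (I : Type) (r : seq I) (f : I -> borel G -> R) :
  (forall i, lc_bounded (f i)) -> lc_bounded (fun s => \sum_(i <- r) f i s).
Proof.
move=> fL; elim: r => [|i r IH].
  by under eq_fun do rewrite big_nil; exact: lc_bounded_cst.
under eq_fun do rewrite big_cons -[f i _]mul1r; exact: lc_bounded_lin.
Qed.

Lemma mean_sum (I : Type) (r : seq I) (f : I -> borel G -> R) :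
  (forall i, lc_bounded (f i)) -> m (fun s => \sum_(i <- r) f i s) = \sum_(i <- r) m (f i).
Proof.
move=> fL; elim: r => [|i r IH].
  by rewrite big_nil; under eq_fun do rewrite big_nil; exact: mean0.
rewrite big_cons; under eq_fun do rewrite big_cons -[f i _]mul1r.
by rewrite mean_lin// ?IH ?mul1r//; exact: lc_bounded_sum.
Qed.

Variables (o : V) (S theta : V -> V -> R).
Hypothesis mass_transport : forall (F : V -> V -> R) (t : R), (forall x y, 0 <= F x y) ->
  (forall (g : G) x y, F (act g x) (act g y) = F x y) ->
  has_sum (F o) t -> has_sum (F ^~ o) t.
Hypotheses (S_sym : forall x y, S x y = S y x)
  (S_inv : forall (g : G) x y, S (act g x) (act g y) = S x y)
  (S_sum : exists sS, forall x, has_sum (S x) sS)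
  (theta_antisym : forall x y, theta y x = - theta x y)
  (theta_le : forall x y, `|theta x y| <= S x y).

Let S_ge0 x y : 0 <= S x y. Proof. exact: le_trans (theta_le x y). Qed.

Let phi x y : borel G -> R := fun s : G => theta (act s^-1%g x) (act s^-1%g y).

Let phi_lcb x y : lc_bounded (phi x y).
Proof.
split=> [s|].
  by apply: filterS2 (near_actV s x) (near_actV s y) => t tx ty; rewrite /phi tx ty.
by exists (S x y) => s; rewrite -(S_inv (s : G)^-1%g x y); exact: theta_le.
Qed.

Let avg x y : R := m (phi x y).

(** Moving both points by [g] translates the averaged function on the left by [g^-1]. *)
Let avg_inv (g : G) x y : avg (act g x) (act g y) = avg x y.
Proof.
have [_ _ _ _ minv] := m_mean.
rewrite /avg -(minv g^-1%g _ (lc_bounded_Lfun (phi_lcb x y))); congr m; apply/funext => s.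
by rewrite /phi invgM invgK.
Qed.

Let avg_antisym x y : avg y x = - avg x y.
Proof.
have := mean_lin (-1) (phi_lcb x y) (lc_bounded_cst 0); rewrite mean0 addr0 mulN1r => <-.
by congr m; apply/funext => s; rewrite /phi theta_antisym /= mulN1r addr0.
Qed.

Let avg_ge x y : - S x y <= avg x y.
Proof.
apply: mean_ge => // s; rewrite -(S_inv (s : G)^-1%g x y).
by have := theta_le (act (s : G)^-1%g x) (act (s : G)^-1%g y); rewrite ler_norml => /andP[].
Qed.

(** Mass transport needs nonnegative masses, so it is applied to [avg + S]. By antisymmetry the
    inflow at [o] is the sum of [S - avg]; equating it with the outflow cancels [S]. *)
Let avg_has_sum : has_sum (avg o) 0.
Proof.
have [sS HS] := S_sum; pose F x y := avg x y + S x y.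
have F0 x y : 0 <= F x y by rewrite /F; have := avg_ge x y; lra.
have [y|t Ft] := @has_sum_dom _ _ (F o) (fun y => 2 * S o y) _ _ (has_sumZ 2 (HS o)).
  by rewrite F0 /F; have := avg_ge y o; rewrite avg_antisym S_sym; lra.
have := mass_transport F0 _ Ft.
move=> /(_ (fun g x y => congr2 +%R (avg_inv g x y) (S_inv g x y))) Ft'.
have := has_sumZ 2^-1 (has_sumB Ft Ft'); rewrite subrr mulr0.
by apply: eq_has_sum => y; rewrite /F avg_antisym (S_sym y o); lra.
Qed.

(* The mean of the divergence of theta over the group equals the divergence at o of the
   averaged, Gamma-invariant and antisymmetric flow, which vanishes by mass transport. *)
Lemma amenable_no_drift kappa : 0 < kappa ->
  ~ (forall x, exists t, has_sum (theta x) t /\ kappa <= t).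
Proof.
move=> k0 H; have [sS HS] := S_sum; pose e := kappa / 3.
have e0 : 0 < e by rewrite divr_gt0.
(* The mean commutes with finite sums only. The tail of [S] gives a truncation valid for all [s] at
   once; it costs one [e], the sum of [avg o] costs another, and [2 * e < kappa]. *)
have [J0 tail] := has_sum_tail (S_ge0 o) (HS o) e0.
have [J1 /(_ (J0 `|` J1)%fset (fsubsetUr _ _))] := (has_sumP _ _).1 avg_has_sum e e0.
set J := (_ `|` _)%fset; rewrite sub0r normrN => le1.
suff : kappa - e <= \sum_(y <- J) avg o y.
  by move: le1; rewrite ler_norml => /andP[_]; rewrite /e; lra.
rewrite /avg -mean_sum//; apply: mean_ge => [|s]; first exact: lc_bounded_sum.
have [t [ht kt]] := H (act (s : G)^-1%g o).
have hphi : has_sum (fun y => phi o y s) t.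
  (* Adding [S] makes the terms nonnegative, as reindexing by [act s^-1] requires. *)
  have h1 := has_sumD ht (HS (act (s : G)^-1%g o)).
  have h0 y : 0 <= theta (act (s : G)^-1%g o) y + S (act (s : G)^-1%g o) y.
    by have := theta_le (act (s : G)^-1%g o) y; rewrite ler_norml => /andP[? ?]; lra.
  have h2 := has_sum_reindex (act_bij (s : G)^-1%g) h0 h1.
  have := has_sumB h2 (HS o); rewrite addrK; apply: eq_has_sum => y.
  by rewrite /= S_inv addrK.
have phi_le y : `|phi o y s| <= S o y.
  by rewrite -(S_inv (s : G)^-1%g o y); exact: theta_le.
have := has_sum_tail_le phi_le hphi tail (fsubsetUl J0 J1).
by rewrite ler_norml => /andP[_]; rewrite -/J; lra.
Qed.

End Drift.

(** * Exponential decay produces a flow with drift *)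

Lemma nat_has_sum_bounded (R : realType) (f : nat -> R) M : (forall n, 0 <= f n) ->
  (forall n, \sum_(0 <= i < n) f i <= M) -> exists2 s, has_sum f s & s <= M.
Proof.
move=> f0 fM.
have le : (\esum_(i in [set: nat]) (f i)%:E <= M%:E)%E.
  rewrite -nneseries_esumT; last by move=> n; rewrite lee_fin.
  apply: lime_le; first by apply: is_cvg_nneseries => n _ _; rewrite lee_fin.
  by apply: nearW => n; rewrite sumEFin lee_fin.
have [s fs] := esum_has_sum f0 (le_lt_trans le (ltry M)).
by exists s => //; rewrite -lee_fin -((has_sum_esum s f0).1 fs).
Qed.

Lemma nat_has_sum_ge (R : realType) (f : nat -> R) s n : (forall n, 0 <= f n) ->
  has_sum f s -> \sum_(0 <= i < n) f i <= s.
Proof.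
move=> f0 fs; have := has_sum_ge_partial [fset i in iota 0 n]%fset f0 fs.
apply: le_trans; rewrite /index_iota subn0 [leRHS](perm_big (iota 0 n))//=.
apply: uniq_perm; rewrite ?iota_uniq ?fset_uniq// => i.
by rewrite inE.
Qed.

Lemma geometric_sum_le (R : realType) (q : R) n : 0 <= q < 1 ->
  \sum_(0 <= i < n) q ^+ i <= (1 - q)^-1.
Proof.
move=> /andP[q0 q1]; have h : (1 - q) * \sum_(0 <= i < n) q ^+ i = 1 - q ^+ n.
  elim: n => [|n IH]; first by rewrite big_geq// mulr0 expr0 subrr.
  by rewrite big_nat_recr//= mulrDr IH exprS; lra.
rewrite -[leRHS]mul1r ler_pdivlMr ?subr_gt0// mulrC h.
by have := exprn_ge0 n q0; lra.
Qed.

Lemma expr_lt_eventually (R : realType) (r e : R) : 0 <= r < 1 -> 0 < e ->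
  exists n, r ^+ n <= e.
Proof.
move=> /andP[r0 r1] e0.
have /cvgrPdist_le/(_ e e0) : (fun n => r ^+ n) @ \oo --> 0.
  by apply: cvg_expr; rewrite ger0_norm.
case=> n _ /(_ n (leqnn n)); rewrite sub0r normrN ger0_norm ?exprn_ge0//.
by exists n.
Qed.

Section Decay.
Context {R : realType} {V : countType}.
Variable P : V -> V -> R.
Hypothesis P_stochastic : stochastic P.
Hypothesis P_symmetric : forall x y, P x y = P y x.
Variable p : nat -> R.
Hypothesis lazyn_diag : forall n x, lazyn P n x x = p n.
Variable o : V.
Variables (E : rel V) (pstar : R).
Hypotheses (E_connected : connected_graph E) (pstar_gt0 : 0 < pstar)
  (pstar_le : forall x y, E x y -> pstar <= P x y).
Hypothesis V_infinite : infinite_set [set: V].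

Local Notation U := (lazyn P).
Local Notation d := (decr p).

Let U_ge0 n x y : 0 <= U n x y. Proof. exact: lazyn_ge0. Qed.

Lemma lazyn_walk_gt0 n x y : is_walk E x y n -> 0 < U n x y.
Proof.
elim: n x y => [|n IH] x y.
  by move=> /is_walk0 ->; rewrite lazyn0 eqxx.
move=> /is_walkS[z [xz zy]]; apply: lt_le_trans (has_sum_ge_term z _ (lazynS P_stochastic n x y)).
  rewrite mulr_gt0 ?IH// /lazy divr_gt0// ltr_wpDl//.
  by apply: lt_le_trans (pstar_le xz).
by move=> w; rewrite mulr_ge0// lazy_ge0.
Qed.

Lemma lazyn_diag_gt0 n : 0 < p n.
Proof.
rewrite -(lazyn_diag n o); elim: n => [|n IH].
  by rewrite lazyn0 eqxx.
apply: lt_le_trans (has_sum_ge_term o _ (lazynS P_stochastic n o o)).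
  by rewrite mulr_gt0// /lazy eqxx divr_gt0// ltr_wpDr// P_stochastic.1.
by move=> w; rewrite mulr_ge0// lazy_ge0.
Qed.

Variable r : R.
Hypothesis r01 : 0 <= r < 1.
Hypothesis d_decay : forall k, d k.*2.+1 <= r * d k.*2.

Let r0 : 0 <= r. Proof. by case/andP: r01. Qed.

Lemma p_le1 n : p n <= 1.
Proof. by rewrite -(lazyn_diag n o); case/andP: (lazyn_01 P_stochastic n o o). Qed.

Lemma decr_geom k : d k.*2 <= r ^+ k.
Proof.
elim: k => [|k IH].
  by rewrite expr0 /decr; have := p_le1 0; have := lazyn_diag_gt0 1; rewrite /=; lra.
apply: (le_trans (decr_even_le P_stochastic P_symmetric lazyn_diag o k)).
by apply: (le_trans (d_decay k)); rewrite exprS ler_wpM2l.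
Qed.

(** Each step of length two loses [d (2i) + d (2i+1) <= 2 d (2i) <= 2 r^i]; the rest is a geometric
    sum. *)
Lemma p_telescope k j : p k.*2 <= p (k + j).*2 + 2 / (1 - r) * (r ^+ k - r ^+ (k + j)).
Proof.
elim: j => [|j IH]; first by rewrite addn0 subrr mulr0 addr0.
apply: (le_trans IH); rewrite addnS doubleS exprS.
have := decr_geom (k + j); have := decr_odd_le P_stochastic P_symmetric lazyn_diag o (k + j).
rewrite /decr => h1 h2.
have hr : (1 - r) != 0 by case/andP: r01 => _ ?; rewrite subr_eq0 gt_eqF.
have h3 : 2 / (1 - r) * (1 - r) = 2 by rewrite divfK.
move: h1 h2 h3; move: (2 / (1 - r)) (p _) (p _) (p _) (r ^+ (k + j)) (r ^+ k) => A a b c x y.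
move=> h1 h2 h3; have -> : A * (y - r * x) = A * (y - x) + A * (1 - r) * x by lra.
rewrite h3; lra.
Qed.

(** On [n] fixed points [y], [U (o, y)] is close to the diagonal value by [lazyn_dist] and the decay
    of [d]. Since these probabilities sum to at most 1, [n * p <= 2]; infinitude of [V] allows
    [n > 2 / e]. *)
Lemma p_to0 e : 0 < e -> forall k, exists j, p (k + j).*2 <= e.
Proof.
move=> e0 k; pose n := (Num.truncn (2 / e)).+1.
have [J _ Jn] := infinite_set_fset n V_infinite.
pose C := \sum_(y <- J) (graph_dist E o y)%:R ^+ 2 * (2 / pstar).
have C0 : 0 <= C.
  by apply: sumr_ge0 => y _; rewrite mulr_ge0 ?sqr_ge0// divr_ge0// ltW.
(* [C + 1] replaces [C], which is only known to be nonnegative; the total error is still at most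
   1. *)
have C1 : 0 < (C + 1)^-1 by rewrite invr_gt0; lra.
have [j rj] := expr_lt_eventually r01 C1.
exists j.
have rkj : r ^+ (k + j) <= (C + 1)^-1.
  by apply: le_trans rj; rewrite exprD ler_piMl ?exprn_ge0// exprn_ile1//; case/andP: r01 => _ /ltW.
have Cr : C * r ^+ (k + j) <= 1.
  by apply: (le_trans (ler_wpM2l C0 rkj)); rewrite ler_pdivrMr; lra.
have H := has_sum_ge_partial J (U_ge0 (k + j).*2 o) (has_sum_lazyn P_stochastic (k + j).*2 o).
have : \sum_(y <- J) (p (k + j).*2 - (graph_dist E o y)%:R ^+ 2 * (2 / pstar) * r ^+ (k + j)) <= 1.
  apply: le_trans H; apply: ler_sum => y _.
  have H1 := lazyn_dist P_stochastic P_symmetric lazyn_diag E_connected pstar_gt0 pstar_le (k + j) o y.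
  have e1 : 2 * d (k + j).*2 / pstar = 2 / pstar * d (k + j).*2 by rewrite mulrAC.
  rewrite e1 mulrA in H1; have dr := decr_geom (k + j).
  have : 0 <= (graph_dist E o y)%:R ^+ 2 * (2 / pstar).
    by rewrite mulr_ge0 ?sqr_ge0// divr_ge0// ltW.
  move: H1; move: (_ * (2 / pstar)) => c h1 c0.
  have := ler_wpM2l c0 dr; lra.
rewrite sumrB -mulr_suml -/C big_const_seq count_predT iter_addr addr0 -mulr_natl => h.
have nJ : n%:R <= (size J)%:R :> R by rewrite ler_nat.
have np : n%:R * p (k + j).*2 <= 2.
  have := ler_wpM2r (ltW (lazyn_diag_gt0 (k + j).*2)) nJ; lra.
have : 2 / e < n%:R by exact: truncnS_gt.
rewrite ltr_pdivrMr// => ne; rewrite leNgt; apply/negP => ep.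
have n0 : 0 < n%:R :> R by rewrite ltr0n.
have : n%:R * e < n%:R * p (k + j).*2 by rewrite ltr_pM2l.
lra.
Qed.

Lemma p_geom k : p k.*2 <= 2 / (1 - r) * r ^+ k.
Proof.
apply/ler_addgt0Pr => e e0; have [j pj] := p_to0 e0 k.
apply: (le_trans (p_telescope k j)).
have : 0 <= 2 / (1 - r) by rewrite divr_ge0// subr_ge0; case/andP: r01 => _ /ltW.
move: (2 / (1 - r)) => A A0; have := mulr_ge0 A0 (exprn_ge0 (k + j) r0); lra.
Qed.

(* h x = sum_k s^-k T^(2k)(x, o) with r < s < 1. *)
Lemma superharmonic : exists (h : V -> R) (s : R), [/\ s < 1, forall x, 0 < h x &
  forall x, exists2 t, has_sum (fun y => U 2 x y * h y) t & t <= s * h x].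
Proof.
case/andP: r01 => _ r1.
have [s [s0 rs s1]] : exists s : R, [/\ 0 < s, r < s & s < 1].
  by exists ((1 + r) / 2); split; have := r0; lra.
pose A := 2 / (1 - r); have A0 : 0 <= A by rewrite divr_ge0// subr_ge0 ltW.
pose a k x := s ^- k * U k.*2 x o.
have a0 k x : 0 <= a k x by rewrite mulr_ge0// invr_ge0 exprn_ge0// ltW.
have rs01 : 0 <= r / s < 1 by rewrite divr_ge0 ?(ltW s0)//= ltr_pdivrMr ?mul1r.
have a_le k x : a k x <= A * (r / s) ^+ k.
  rewrite /a exprMn exprVn [leRHS]mulrA [leRHS]mulrC ler_pM2l ?invr_gt0 ?exprn_gt0//.
  by apply: le_trans (p_geom k); exact: lazyn_le_diag.
have hex x : exists2 t, has_sum (a ^~ x) t & t <= A * (1 - r / s)^-1.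
  apply: nat_has_sum_bounded => // n.
  apply: (@le_trans _ _ (\sum_(0 <= i < n) A * (r / s) ^+ i)); first exact: ler_sum.
  by rewrite -mulr_sumr ler_wpM2l// geometric_sum_le.
pose h x := projT1 (cid2 (hex x)).
have hP x : has_sum (a ^~ x) (h x) by rewrite /h; case: cid2.
exists h, s; split=> // x.
  (* Only even powers occur in [h], so the walk of length [n] from [x] to [o] is completed by [n]
     steps from [o] back to [o]. *)
  have [n xo] := E_connected x o.
  apply: lt_le_trans (has_sum_ge_term n _ (hP x)) => //.
  rewrite mulr_gt0 ?invr_gt0 ?exprn_gt0//.
  have := lazynD P_stochastic n n x o; rewrite addnn => H.
  apply: lt_le_trans (has_sum_ge_term o _ H); last by move=> z; rewrite mulr_ge0.
  by rewrite lazyn_diag mulr_gt0 ?lazyn_walk_gt0 ?lazyn_diag_gt0.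
(* Applying [T^2] shifts the series by one index and multiplies it by [s]; the term [a 0 x] is
   dropped. *)
have shift n : \sum_(0 <= i < n) s * a i.+1 x <= s * h x.
  rewrite -mulr_sumr ler_pM2l//; apply: le_trans (nat_has_sum_ge n.+1 (a0^~ x) (hP x)).
  by rewrite [leRHS]big_nat_recl//= lerDr.
have [t ht ts] := nat_has_sum_bounded (fun n => mulr_ge0 (ltW s0) (a0 n.+1 x)) shift.
exists t => //.
apply: (@has_sum_exchange _ _ _ (fun k y => U 2 x y * a k y) (fun k => s * a k.+1 x)) => //.
- by move=> k y; rewrite mulr_ge0.
- move=> k; have := has_sumZ (s ^- k) (lazynD P_stochastic 2 k.*2 x o).
  rewrite /a doubleS add2n exprS invfM !mulrA mulfV ?gt_eqF// mul1r.
  by apply: eq_has_sum => y; rewrite mulrCA.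
- by move=> y; apply: has_sumZ.
Qed.

(* theta is the flow U 2 x y (h x - h y) / (h x + h y), whose divergence is bounded below because
   (h x - h y) / (h x + h y) >= (1 - h y / h x) / 2. *)
Lemma drift_flow : exists (theta : V -> V -> R) (kappa : R),
  [/\ 0 < kappa, forall x y, theta y x = - theta x y, forall x y, `|theta x y| <= U 2 x y &
    forall x, exists t, has_sum (theta x) t /\ kappa <= t].
Proof.
have [h [s [s1 h0 hs]]] := superharmonic.
pose theta x y := U 2 x y * ((h x - h y) / (h x + h y)).
have hxy x y : 0 < h x + h y by rewrite addr_gt0.
have th_le x y : `|theta x y| <= U 2 x y.
  rewrite normrM (ger0_norm (U_ge0 _ _ _)) ler_piMr//.
  rewrite normrM normfV (gtr0_norm (hxy x y)) ler_pdivrMr// mul1r ler_norml.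
  by apply/andP; split; have := h0 x; have := h0 y; lra.
exists theta, ((1 - s) / 2); split=> //; first by rewrite divr_gt0// subr_gt0.
  move=> x y; rewrite /theta (lazynC P_stochastic P_symmetric 2 y) -mulrN -mulNr opprB.
  by rewrite (addrC (h y) (h x)).
move=> x; have [t ht] := has_sum_abs_dom (th_le x) (has_sum_lazyn P_stochastic 2 x).
exists t; split=> //; have [t' ht' t's] := hs x.
have := has_sumZ 2^-1 (has_sumB (has_sum_lazyn P_stochastic 2 x) (has_sumZ (h x)^-1 ht')).
move=> /has_sum_le/(_ ht); set l := 2^-1 * _ => H.
have {}H : l <= t.
  apply: H => y; rewrite /theta.
  have -> : 2^-1 * (U 2 x y - (h x)^-1 * (U 2 x y * h y)) =
      U 2 x y * ((h x - h y) / (2 * h x)).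
    rewrite invfM mulrBl (mulrCA (h x)) mulfV ?gt_eqF// mulr1; lra.
  rewrite ler_wpM2l// ler_pdivrMr ?mulr_gt0// mulrAC ler_pdivlMr//.
  (* After clearing denominators, the bound by [(h x - h y) / (2 * h x)] is
     [(h x - h y) ^+ 2 >= 0]. *)
  have := sqr_ge0 (h x - h y); rewrite expr2; lra.
apply: le_trans H; rewrite /l.
have : (h x)^-1 * t' <= s by rewrite mulrC ler_pdivrMr.
lra.
Qed.

End Decay.

(** * The limit kernel and the harmonic map *)

(** Compactness of [[-M, M]] gives a cluster point, and an ultrafilter converges to its cluster
    points. *)
Lemma ultra_bounded_cvg (R : realType) (T : Type) (F : set_system T)
    (FF : UltraFilter F) (f : T -> R) (M : R) : (forall k, `|f k| <= M) ->
  f @ F --> lim (f @ F).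
Proof.
move=> fM; have fF : (f @ F) `[- M, M]%classic.
  by apply: (@filterE _ F) => k; rewrite /= in_itv /= -ler_norml; exact: fM.
have [l [_ cl]] := @segment_compact R (- M) M (f @ F) _ fF.
apply/cvg_ex; exists l => B Bl.
case: (in_ultra_setVsetC (f @^-1` B) FF) => // FnB.
by have [y []] := cl (~` B) B FnB Bl.
Qed.

(** If [K] is the Gram kernel of [f], this is the inner product of [f i.1 - f i.2] and
    [f j.1 - f j.2]. Terms of [K] depending on one variable cancel, so kernels of negative type
    become positive semidefinite. *)
Definition increment_kernel (R : zmodType) (V : Type) (K : V -> V -> R) (i j : V * V) : R :=
  K i.1 j.1 + K i.2 j.2 - K i.1 j.2 - K i.2 j.1.

Lemma increment_kernel_psd (R : realType) (V : Type) (K : V -> V -> R) :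
  (forall t : seq (R * V), 0 <= \sum_(a <- t) \sum_(b <- t) a.1 * b.1 * K a.2 b.2) ->
  forall t : seq (R * (V * V)),
    0 <= \sum_(a <- t) \sum_(b <- t) a.1 * b.1 * increment_kernel K a.2 b.2.
Proof.
move=> Kpsd t.
have := Kpsd ([seq (a.1, a.2.1) | a <- t] ++ [seq (- a.1, a.2.2) | a <- t]).
move=> /le_trans; apply; rewrite le_eqVlt; apply/orP; left; apply/eqP.
rewrite big_cat /= !big_map -big_split /=.
apply: eq_bigr => a _; rewrite !big_cat /= !big_map -!big_split /=.
by apply: eq_bigr => b _; rewrite /increment_kernel; lra.
Qed.

Section HarmonicLimit.
Context {R : realType} {V : countType} {P : V -> V -> R} {Gamma : groupClosed (AutP P)}.

Notation G := (subgroup Gamma).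

Hypothesis P_stochastic : stochastic P.
Hypothesis P_symmetric : forall x y, P x y = P y x.
Variable p : nat -> R.
Hypothesis lazyn_diag : forall n x, lazyn P n x x = p n.
Variable o : V.
Variables (E : rel V) (pstar : R).
Hypotheses (E_symmetric : symmetric E)
  (E_connected : connected_graph E) (pstar_gt0 : 0 < pstar)
  (pstar_le : forall x y, E x y -> pstar <= P x y).
Hypothesis P_moment : forall x,
  (\esum_(y in [set: V]) (P x y * (graph_dist E x y)%:R ^+ 2)%:E < +oo)%E.

Local Notation U := (lazyn P).
Local Notation d := (decr p).
Local Notation dist x y := ((graph_dist E x y)%:R : R).

Variable k_ : nat -> nat.
Hypothesis d_ratio : forall j,
  0 < d (k_ j).*2 /\ d (k_ j).*2 - d (k_ j).*2.+1 <= d (k_ j).*2 / j.+1%:R.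

Variables (F : set_system nat) (FF : UltraFilter F).
Hypothesis F_oo : \oo `<=` F.

Let P_ge0 x y : 0 <= P x y. Proof. exact: P_stochastic.1. Qed.

Let UC n x y : U n x y = U n y x. Proof. exact: lazynC. Qed.

(** The kernel [N_k] at [k = k_ j], normalised to have energy 1. *)
Definition sqd j x y : R := (p (k_ j).*2 - U (k_ j).*2 x y) / (2 * d (k_ j).*2).

Lemma sqd_ge0 j x y : 0 <= sqd j x y.
Proof.
have [d0 _] := d_ratio j.
by rewrite divr_ge0 ?mulr_ge0 ?(ltW d0)// subr_ge0 lazyn_le_diag.
Qed.

Lemma sqd_le j x y : sqd j x y <= dist x y ^+ 2 / pstar.
Proof.
have [d0 _] := d_ratio j.
rewrite ler_pdivrMr ?mulr_gt0// mulrAC -mulrA.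
exact: lazyn_dist.
Qed.

Lemma sqdC j x y : sqd j x y = sqd j y x.
Proof. by rewrite /sqd UC. Qed.

Lemma has_sum_sqd j x : has_sum (fun z => P x z * sqd j x z) 1.
Proof.
have [d0 _] := d_ratio j.
have := has_sumZ (2 * d (k_ j).*2)^-1 (has_sum_energy P_stochastic P_symmetric lazyn_diag (k_ j) x).
rewrite mulVf ?mulf_neq0 ?(gt_eqF d0)//.
by apply: eq_has_sum => z; rewrite /sqd mulrCA [_^-1 * _]mulrC.
Qed.

Lemma sqd_aut (g : G) j x y : sqd j (act g x) (act g y) = sqd j x y.
Proof. by rewrite /sqd (lazyn_aut P_stochastic (act_bij g) (act_P g)). Qed.

Definition sqd_lim x y : R := lim ((fun j => sqd j x y) @ F).

Lemma sqd_cvg x y : (fun j => sqd j x y) @ F --> sqd_lim x y.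
Proof.
apply: (ultra_bounded_cvg FF (M := dist x y ^+ 2 / pstar)) => j.
by rewrite ger0_norm ?sqd_ge0 ?sqd_le.
Qed.

Lemma sqd_limC x y : sqd_lim x y = sqd_lim y x.
Proof. by rewrite /sqd_lim; congr (lim (_ @ F)); apply/funext => j; rewrite sqdC. Qed.

Lemma sqd_lim_aut (g : G) x y : sqd_lim (act g x) (act g y) = sqd_lim x y.
Proof. by rewrite /sqd_lim; congr (lim (_ @ F)); apply/funext => j; rewrite sqd_aut. Qed.

Lemma sqd_lim_le x y : sqd_lim x y <= dist x y ^+ 2 / pstar.
Proof.
by have /cvg_le_cst := @sqd_cvg x y; apply; apply: filterE => j; exact: sqd_le.
Qed.

Lemma sqd_limxx x : sqd_lim x x = 0.
Proof.
rewrite /sqd_lim (_ : (fun j => sqd j x x) = cst 0) ?lim_cst//.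
by apply/funext => j; rewrite /sqd lazyn_diag subrr mul0r.
Qed.

Definition sqd_gram j : V * V -> V * V -> R := increment_kernel (fun x y => - sqd j x y / 2).

Definition sqd_lim_gram : V * V -> V * V -> R := increment_kernel (fun x y => - sqd_lim x y / 2).

Lemma sqd_gram_cvg i i' : (fun j => sqd_gram j i i') @ F --> sqd_lim_gram i i'.
Proof.
have h x y : (fun j => - sqd j x y / 2) @ F --> - sqd_lim x y / 2.
  by apply: cvgMl; apply: cvgN; exact: sqd_cvg.
by apply: cvgB (h _ _); apply: cvgB (h _ _); apply: cvgD (h _ _) (h _ _).
Qed.

(** The constant [p (2k)] cancels in increments, which leaves the increments of [T^(2k)] divided by
    [4 d (2k)]. *)
Lemma sqd_gram_psd j (t : seq (R * (V * V))) :
  0 <= \sum_(a <- t) \sum_(b <- t) a.1 * b.1 * sqd_gram j a.2 b.2.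
Proof.
have [d0 _] := d_ratio j.
have := increment_kernel_psd (lazyn_psd P_stochastic P_symmetric (k_ j)) t.
set S := (X in 0 <= X -> _) => S0.
rewrite [leRHS](_ : _ = (4 * d (k_ j).*2)^-1 * S).
  by rewrite mulr_ge0// invr_ge0 mulr_ge0// ltW.
rewrite /S mulr_sumr; apply: eq_bigr => a _; rewrite mulr_sumr; apply: eq_bigr => b _.
rewrite mulrCA; congr (_ * _); rewrite /sqd_gram /increment_kernel /sqd.
have -> : (4 * d (k_ j).*2)^-1 = (2 * d (k_ j).*2)^-1 / 2.
  by rewrite -invfM mulrAC -natrM.
lra.
Qed.

Lemma sqd_lim_gram_sym i j : sqd_lim_gram i j = sqd_lim_gram j i.
Proof.
rewrite /sqd_lim_gram /increment_kernel (sqd_limC i.1 j.1) (sqd_limC i.2 j.2) (sqd_limC i.1 j.2) (sqd_limC i.2 j.1).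
lra.
Qed.

Lemma sqd_lim_gram_psd (t : seq (R * (V * V))) :
  0 <= \sum_(a <- t) \sum_(b <- t) a.1 * b.1 * sqd_lim_gram a.2 b.2.
Proof.
have : (fun j => \sum_(a <- t) \sum_(b <- t) a.1 * b.1 * sqd_gram j a.2 b.2) @ F -->
    \sum_(a <- t) \sum_(b <- t) a.1 * b.1 * sqd_lim_gram a.2 b.2.
  apply: (@cvg_seq_sum R _ _ F _ t
    (fun j a => \sum_(b <- t) a.1 * b.1 * sqd_gram j a.2 b.2)) => a.
  apply: (@cvg_seq_sum R _ _ F _ t (fun j b => a.1 * b.1 * sqd_gram j a.2 b.2)) => b.
  by apply: cvgMr; exact: sqd_gram_cvg.
move=> /cvgN/cvg_le_cst H; rewrite -oppr_le0; apply: H; apply: filterE => j /=.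
by rewrite oppr_le0 sqd_gram_psd.
Qed.

Definition limit_kernel : psd_kernel R (V * V) := PsdKernel sqd_lim_gram_sym sqd_lim_gram_psd.

Local Notation H := (rkhs limit_kernel).

Lemma feature_subproof i : sqd_lim_gram i \in rkhs_pred limit_kernel.
Proof.
apply/asboolP; exists (Num.sqrt (sqd_lim_gram i i)); first exact: sqrtr_ge0.
exact: (ev_le_feature limit_kernel i).
Qed.

Definition feature i : H := Rkhs (feature_subproof i).

Lemma sqd_lim_gram_cocycle x y z i : sqd_lim_gram (x, z) i = sqd_lim_gram (x, y) i + sqd_lim_gram (y, z) i.
Proof. by rewrite /sqd_lim_gram /increment_kernel /=; lra. Qed.

Lemma sqd_lim_gram_diag x y : sqd_lim_gram (x, y) (x, y) = sqd_lim x y.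
Proof. by rewrite /sqd_lim_gram /increment_kernel /= !sqd_limxx (sqd_limC y x); lra. Qed.

Lemma sqd_lim_gram0 x i : sqd_lim_gram (x, x) i = 0.
Proof. by rewrite /sqd_lim_gram /increment_kernel /=; lra. Qed.

Lemma feature_norm x y : `|feature (x, y)| <= Num.sqrt (sqd_lim x y).
Proof.
apply: rkhs_norm_le; first exact: sqrtr_ge0.
by rewrite -sqd_lim_gram_diag; exact: (ev_le_feature limit_kernel (x, y)).
Qed.

Definition harmonic_embedding (x : V) : H := feature (x, o).

Lemma has_sum_moment x : exists s, has_sum (fun y => P x y * dist x y ^+ 2) s.
Proof.
by apply: esum_has_sum => // y; rewrite mulr_ge0// sqr_ge0.
Qed.

Lemma has_sum_moment_affine x a b :
  exists s, has_sum (fun y => P x y * (a * dist x y ^+ 2 + b)) s.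
Proof.
have [s hs] := has_sum_moment x.
exists (a * s + b * 1).
apply: eq_has_sum (has_sumD (has_sumZ a hs) (has_sumZ b (has_sum_P P_stochastic x))) => y.
lra.
Qed.

Lemma dist_sqr_le x y z : dist z y ^+ 2 <= 2 * dist x z ^+ 2 + 2 * dist x y ^+ 2.
Proof.
have : dist z y <= dist x z + dist x y.
  rewrite -natrD ler_nat (graph_dist_sym x z)//; exact: graph_dist_triangle.
have : 0 <= dist z y by [].
move: (dist z y) (dist x z) (dist x y) => a b c a0 abc.
have : a ^+ 2 <= (b + c) ^+ 2 by rewrite ler_sqr ?nnegrE//; exact: le_trans abc.
have := sqr_ge0 (b - c); rewrite sqrrB sqrrD; lra.
Qed.

(** A constant map would make [sqd_lim o] vanish. But the energy 1 of [sqd j] survives the limit by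
    dominated convergence, with the second moment as majorant. *)
Lemma harmonic_embedding_nonconstant : exists x y, harmonic_embedding x <> harmonic_embedding y.
Proof.
apply: contrapT => /forallNP h; have {}h x y : harmonic_embedding x = harmonic_embedding y.
  by apply: contrapT => xy; apply: (h x); exists y.
have N0 x : sqd_lim o x = 0.
  rewrite sqd_limC -sqd_lim_gram_diag; have /(congr1 (fun f : H => f (x, o))) /= := h x o.
  by move=> ->; rewrite sqd_lim_gram0.
have [s hs] := has_sum_moment o.
have : has_sum (fun z => P o z * sqd_lim o z) 1.
  apply: (has_sum_cvg (F := F) (f := fun j z => P o z * sqd j o z) (s := fun=> 1)
    (b := fun z => P o z * (dist o z ^+ 2 / pstar))).
  - move=> j z; rewrite normrM (ger0_norm (P_ge0 _ _)) ler_wpM2l//.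
    by rewrite ger0_norm ?sqd_ge0 ?sqd_le.
  - by have := has_sumZ pstar^-1 hs; apply: eq_has_sum => z; rewrite mulrC -mulrA.
  - by move=> j; exact: has_sum_sqd.
  - by move=> z; apply: cvgMr; exact: sqd_cvg.
  - exact: cvg_cst.
have -> : (fun z => P o z * sqd_lim o z) = fun=> 0 by apply/funext => z; rewrite N0 mulr0.
by move=> /has_sum_unique/(_ has_sum0)/eqP; rewrite oner_eq0.
Qed.

Lemma decr_ker_ratio j x u : `|1 - decr_ker P (k_ j) x u / d (k_ j).*2| <= dist x u ^+ 2 * (2 / pstar) / j.+1%:R.
Proof.
have [d0 dr] := d_ratio j.
have e1 (a b : R) : 0 < a -> 1 - b / a = (a - b) / a.
  by move=> a0; rewrite mulrBl divff// gt_eqF.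
rewrite e1// ger0_norm; last by rewrite divr_ge0 ?(ltW d0)// subr_ge0 decr_ker_le_diag.
rewrite ler_pdivrMr//.
apply: le_trans (decr_ker_dist P_stochastic P_symmetric lazyn_diag E_connected pstar_gt0 pstar_le (k_ j) x u) _.
have c0 : 0 <= dist x u ^+ 2 * (2 / pstar) by rewrite mulr_ge0 ?sqr_ge0// divr_ge0// ltW.
have := ler_wpM2l c0 dr; move: (dist x u ^+ 2) c0 => D c0.
have -> : D * (2 * (d (k_ j).*2 - d (k_ j).*2.+1) / pstar) =
  D * (2 / pstar) * (d (k_ j).*2 - d (k_ j).*2.+1) by rewrite -!mulrA [_ / pstar]mulrC.
have e2 (c a b : R) : c * (a * b) = c * b * a by rewrite mulrA mulrAC.
by rewrite (e2 (D * (2 / pstar))).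
Qed.

(** Harmonicity tested against the increment [(u, v)]. At stage [j] the sum of [P x z] times
    [sqd_gram j (z, x) (u, v)] is an explicit difference of [decr_ker] terms, which tends to 0 by
    [decr_ker_ratio]. *)
Lemma harmonic_weak x i : has_sum (fun z => P x z * sqd_lim_gram (z, o) i) (sqd_lim_gram (x, o) i).
Proof.
case: i => u v.
(* A majorant independent of [j], from [sqd_le] and [dist_sqr_le]. *)
have [sb hb] := has_sum_moment_affine x (2 / pstar) (3 / 2 / pstar * (dist x u ^+ 2 + dist x v ^+ 2)).
have h0 : has_sum (fun z => P x z * sqd_lim_gram (z, x) (u, v)) 0.
  apply: (has_sum_cvg (F := F) (f := fun j z => P x z * sqd_gram j (z, x) (u, v))
    (s := fun j => ((1 - decr_ker P (k_ j) x u / d (k_ j).*2) - (1 - decr_ker P (k_ j) x v / d (k_ j).*2)) / 2)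
    _ hb).
  - move=> j z; rewrite normrM (ger0_norm (P_ge0 _ _)) ler_wpM2l//.
    rewrite /sqd_gram /increment_kernel /=.
    have := sqd_ge0 j z u; have := sqd_ge0 j x v; have := sqd_ge0 j z v; have := sqd_ge0 j x u.
    have := sqd_le j z u; have := sqd_le j x v; have := sqd_le j z v; have := sqd_le j x u.
    have ps : 0 <= pstar^-1 by rewrite invr_ge0 ltW.
    have := ler_wpM2r ps (dist_sqr_le x u z); have := ler_wpM2r ps (dist_sqr_le x v z).
    move: (sqd _ _ _) (sqd _ _ _) (sqd _ _ _) (sqd _ _ _) => n1 n2 n3 n4.
    move: (dist x z ^+ 2) (dist x u ^+ 2) (dist x v ^+ 2) (dist z u ^+ 2) (dist z v ^+ 2) => d1 d2 d3 d4 d5.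
    by move=> *; rewrite ler_norml; apply/andP; split; lra.
  - move=> j; have [d0 _] := d_ratio j; set k := k_ j.
    have h1 := has_sumB (has_sum_P_lazyn P_stochastic k.*2 x u) (has_sum_P_lazyn P_stochastic k.*2 x v).
    have h2 := has_sumZ (U k.*2 x v - U k.*2 x u) (has_sum_P P_stochastic x).
    have := has_sumZ ((2 * d k.*2)^-1 / 2) (has_sumD h1 h2).
    have -> : (2 * d k.*2)^-1 / 2 * (2 * U k.*2.+1 x u - U k.*2 x u - (2 * U k.*2.+1 x v - U k.*2 x v) +
      (U k.*2 x v - U k.*2 x u) * 1) =
      (1 - decr_ker P k x u / d k.*2 - (1 - decr_ker P k x v / d k.*2)) / 2.
      by rewrite invfM /decr_ker; lra.
    apply: eq_has_sum => z; rewrite /sqd_gram /increment_kernel /sqd /= -/k; lra.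
  - by move=> z; apply: cvgMr; exact: sqd_gram_cvg.
  - have r0 w : (fun j => 1 - decr_ker P (k_ j) x w / d (k_ j).*2) @ F --> 0.
      apply: (@cvg_trans _ ((fun j => 1 - decr_ker P (k_ j) x w / d (k_ j).*2) @ \oo)).
        exact: cvg_app.
      apply/norm_cvg0P; apply: (@squeeze_cvgr _ _ _ _ (fun=> 0) (fun j => dist x w ^+ 2 * (2 / pstar) / j.+1%:R)).
      - by apply: nearW => j; rewrite normr_ge0 decr_ker_ratio.
      - exact: cvg_cst.
      - rewrite -[X in _ --> X](mulr0 (dist x w ^+ 2 * (2 / pstar))).
        by apply: cvgMr; exact: cvg_harmonic.
    have -> : 0 = (0 - 0) / 2 :> R by rewrite subrr mul0r.
    by apply: cvgMl; apply: cvgB.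
have := has_sumD h0 (has_sumZ (sqd_lim_gram (x, o) (u, v)) (has_sum_P P_stochastic x)).
rewrite add0r mulr1; apply: eq_has_sum => z.
by rewrite (sqd_lim_gram_cocycle z x o); lra.
Qed.

(** The norms of the terms are summable, so one finite set controls the tail for all test
    combinations [t]; the weak identities then give convergence in norm. *)
Lemma harmonic_embedding_harmonic : harmonic_map P harmonic_embedding.
Proof.
move=> x; pose b y := P x y * `|harmonic_embedding y|.
have b0 y : 0 <= b y by rewrite mulr_ge0.
have [sb hb] : exists s, has_sum b s.
  have [s hs] := has_sum_moment_affine x (2 / pstar) (1 + 2 / pstar * dist x o ^+ 2).
  apply: has_sum_dom hs => y; rewrite b0 ler_wpM2l//.
  have := feature_norm y o; rewrite -/(harmonic_embedding y).
  have := sqd_lim_le y o; have ps : 0 <= pstar^-1 by rewrite invr_ge0 ltW.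
  have := ler_wpM2r ps (dist_sqr_le x o y).
  have n0 : 0 <= sqd_lim y o.
    by rewrite -sqd_lim_gram_diag; have := gram_ge0 limit_kernel [:: (1, (y, o))]; rewrite /gram !ev1.
  (* Only squared distances are known to be summable, so the norm is bounded through
     [2 * q <= q ^+ 2 + 1]. *)
  have := sqr_sqrtr n0; have := sqr_ge0 (Num.sqrt (sqd_lim y o) - 1); rewrite sqrrB1.
  have := sqrtr_ge0 (sqd_lim y o); move: (Num.sqrt _) => q; lra.
apply/cvgrPdist_le => e e0; have [J0 tail] := has_sum_tail b0 hb e0.
exists J0 => // J J0J /=; rewrite partial_sumE.
apply: rkhs_norm_le; first exact: ltW.
move=> t; have ev_sum : ev (\sum_(y <- J) P x y *: harmonic_embedding y : H) t =
    \sum_(y <- J) P x y * ev (harmonic_embedding y) t.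
  elim: (enum_fset J) => [|y r IH]; last by rewrite !big_cons evD evZ IH.
  by rewrite !big_nil /ev big1// => a _; rewrite mulr0.
rewrite evB ev_sum.
apply: (has_sum_tail_le (b := fun y => b y * Num.sqrt (gram limit_kernel t t)) _ _ _ J0J).
- move=> y; rewrite normrM (ger0_norm (P_ge0 _ _)) /b -mulrA ler_wpM2l//.
  exact: ev_le_norm.
- have := @has_sum_sum R V _ t (fun a y => a.1 * (P x y * sqd_lim_gram (y, o) a.2))
    (fun a => a.1 * sqd_lim_gram (x, o) a.2) (fun a => has_sumZ a.1 (harmonic_weak x a.2)).
  apply: eq_has_sum => y; rewrite /ev mulr_sumr; apply: eq_bigr => a _.
  by rewrite mulrCA.
- move=> J' J0J'; rewrite -mulr_suml ler_wpM2r ?sqrtr_ge0//; exact: tail.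
Qed.

Let gact (g : G) (i : V * V) := (act g i.1, act g i.2).

Lemma sqd_lim_gram_aut g i j : sqd_lim_gram (gact g i) (gact g j) = sqd_lim_gram i j.
Proof. by rewrite /sqd_lim_gram /increment_kernel /= !sqd_lim_aut. Qed.

(** Translating [f] amounts to translating the test combination, which leaves its Gram norm
    unchanged. *)
Lemma ev_le_translate (g : G) c (f : V * V -> R) :
  ev_le limit_kernel c f -> ev_le limit_kernel c (f \o gact g).
Proof.
move=> fc t; pose t' := [seq (a.1, gact g a.2) | a <- t].
have -> : ev (f \o gact g) t = ev f t' by rewrite /ev big_map.
suff -> : gram limit_kernel t t = gram limit_kernel t' t' by [].
rewrite !gramE big_map; apply: eq_bigr => a _; rewrite big_map; apply: eq_bigr => b _ /=.
by rewrite sqd_lim_gram_aut.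
Qed.

Lemma translate_subproof (g : G) (f : H) : f \o gact g \in rkhs_pred limit_kernel.
Proof.
apply/asboolP; exists `|f| => //; apply: ev_le_translate; exact: ev_le_norm.
Qed.

Definition translate (g : G) (f : H) : H := Rkhs (translate_subproof g f).

Lemma translate_norm g f : `|translate g f| <= `|f|.
Proof. by apply: rkhs_norm_le => //; apply: ev_le_translate; exact: ev_le_norm. Qed.

(** The translation part is the image of [act g o] under the embedding; it is a cocycle by
    [sqd_lim_gram_cocycle], which gives the group law. *)
Definition affine_act (g : G) (f : H) : H := translate g^-1%g f + feature (act g o, o).

Lemma affine_actE g f i : affine_act g f i = f (gact g^-1%g i) + sqd_lim_gram (act g o, o) i.
Proof. by []. Qed.

Lemma affine_act_isometric : affine_isometric_action affine_act.
Proof.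
have gactM g h i : gact (g * h)%g i = gact g (gact h i) by [].
have gactK g i : gact g (gact g^-1%g i) = i.
  by case: i => x y; rewrite /gact /= !actVK.
have gactVK g i : gact g^-1%g (gact g i) = i.
  by case: i => x y; rewrite /gact /= !actK.
have kaplV g i j : sqd_lim_gram i (gact g^-1%g j) = sqd_lim_gram (gact g i) j.
  by rewrite -(sqd_lim_gram_aut g) gactK.
have act1 x : act (1%g : G) x = x by [].
have B g u v : affine_act g u - affine_act g v = translate g^-1%g (u - v).
  by apply: rkhs_ext => i; rewrite rkhs_funB !affine_actE [RHS]rkhs_funB; lra.
split.
- move=> v; apply: rkhs_ext => i.
  by rewrite affine_actE act1 sqd_lim_gram0 addr0 invg1; case: i.
- move=> g h v; apply: rkhs_ext => i.
  rewrite !affine_actE invgM gactM kaplV -addrA; congr (_ + _).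
  by rewrite -sqd_lim_gram_cocycle.
- move=> g t u v; apply: rkhs_ext => i.
  rewrite !(affine_actE, rkhs_funD, rkhs_funZ); lra.
- move=> g u v; rewrite B; apply/eqP; rewrite eq_le translate_norm /=.
  have {1}-> : u - v = translate g (translate g^-1%g (u - v)).
    by apply: rkhs_ext => i; rewrite /= gactVK.
  exact: translate_norm.
Qed.

Lemma affine_act_embedding g x : affine_act g (harmonic_embedding x) =
  harmonic_embedding (act g x).
Proof.
apply: rkhs_ext => i; rewrite affine_actE /=.
have -> : sqd_lim_gram (x, o) (gact g^-1%g i) = sqd_lim_gram (act g x, act g o) i.
  rewrite -(sqd_lim_gram_aut g); congr (sqd_lim_gram _ _).
  by case: i => y z; rewrite /gact /= !actVK.
by rewrite -sqd_lim_gram_cocycle.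
Qed.

Lemma exists_harmonic_map : exists (H : hilbertSpace R) (Psi : V -> H),
  [/\ exists x y, Psi x <> Psi y, equivariant_map Gamma Psi & harmonic_map P Psi].
Proof.
exists (rkhs_hilbert limit_kernel), harmonic_embedding; split.
- exact: harmonic_embedding_nonconstant.
- exists affine_act; split; first exact: affine_act_isometric.
  by move=> g x; exact: affine_act_embedding.
- exact: harmonic_embedding_harmonic.
Qed.

End HarmonicLimit.

(** * Proof of the theorem *)

Lemma is_walk_map (V : eqType) (E : rel V) (f : V -> V) x y n :
  (forall u v, E (f u) (f v) = E u v) -> is_walk E x y n -> is_walk E (f x) (f y) n.
Proof.
move=> fE [q [xq qy qn]]; exists (map f q); split.
- by rewrite path_map (eq_path (e' := E)).
- by rewrite last_map qy.
- by rewrite size_map.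
Qed.

(** * Local finiteness of the graph *)

Section LocallyFinite.
Context {R : realType} {V : countType} {P : V -> V -> R}.
Hypothesis P_stochastic : stochastic P.
Variables (E : rel V) (pstar : R).
Hypotheses (pstar_gt0 : 0 < pstar) (pstar_le : forall x y, E x y -> pstar <= P x y).

(** Each neighbor carries mass at least [pstar] out of a total of 1. *)
Lemma finite_neighbors x : finite_set [set y | E x y].
Proof.
apply: contrapT => inf; pose n := (Num.truncn pstar^-1).+1.
have [J JE nJ] := infinite_set_fset n inf.
have H := has_sum_ge_partial J (P_stochastic.1 x) (has_sum_P P_stochastic x).
have : \sum_(y <- J) pstar <= 1.
  apply: le_trans H; rewrite big_seq [leRHS]big_seq; apply: ler_sum => y yJ.
  by apply: pstar_le; exact: JE.
rewrite big_const_seq count_predT iter_addr addr0 -mulr_natl => le1.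
have : pstar^-1 < n%:R by exact: truncnS_gt.
rewrite invf_plt ?posrE ?ltr0n// => h.
have nJ' : n%:R <= (size J)%:R :> R by rewrite ler_nat.
have := ler_wpM2r (ltW pstar_gt0) nJ'.
have : 1 < n%:R * pstar by rewrite -ltr_pdivrMl ?ltr0n// mulr1.
lra.
Qed.

Lemma finite_walks n x : finite_set [set y | is_walk E x y n].
Proof.
elim: n x => [|n IH] x.
  apply: (@sub_finite_set _ _ [set x]); last exact: finite_set1.
  by move=> y /is_walk0 ->.
apply: (@sub_finite_set _ _ (\bigcup_(z in [set z | E x z]) [set y | is_walk E z y n])).
  by move=> y /is_walkS[z [xz zy]]; exists z.
by apply: bigcup_finite => [|z _]; [exact: finite_neighbors|exact: IH].
Qed.

End LocallyFinite.

Theorem theorem3p1 (R : realType) (V : countType)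
    (V_infinite : infinite_set [set: V])
    (P : V -> V -> R)
    (P_stochastic : stochastic P)
    (P_symmetric : forall x y, P x y = P y x)
    (Gamma : groupClosed (AutP P))
    (Gamma_closed : closed [set g : AutP P | g \in Gamma])
    (Gamma_amenable : amenable R (subgroup Gamma))
    (Gamma_unimodular : unimodular R (subgroup Gamma))
    (Gamma_transitive : forall x y, exists2 g, g \in Gamma & aut_fun g x = y)
    (E : rel V)
    (E_symmetric : symmetric E)
    (E_connected : connected_graph E)
    (E_aut : forall g, g \in Gamma ->
      forall x y, E (aut_fun g x) (aut_fun g y) = E x y)
    (P_moment : forall x,
      (\esum_(y in [set: V]) (P x y * (graph_dist E x y)%:R ^+ 2)%:E < +oo)%E)
    (pstar : R)
    (pstar_min : is_min [set P e.1 e.2 | e in [set e | E e.1 e.2]] pstar)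
    (pstar_gt0 : 0 < pstar) :
  exists (H : hilbertSpace R) (Psi : V -> H),
    [/\ exists x y, Psi x <> Psi y, equivariant_map Gamma Psi & harmonic_map P Psi].
Proof.
have [root _] := infinite_setN0 V_infinite.
have trans x y : exists g : subgroup Gamma, act g x = y.
  by have [g gG gxy] := Gamma_transitive x y; exists (exist _ g gG).
have pstar_le x y : E x y -> pstar <= P x y.
  by move=> xy; apply: pstar_min.2; exists (x, y).
pose p n := lazyn P n root root.
have lazyn_diag n x : lazyn P n x x = p n.
  have [g <-] := trans root x.
  by rewrite (lazyn_aut P_stochastic (act_bij g) (act_P g)).
(* The stabilizer of [root] maps a walk from [root] to [x] to walks of the same length from
   [root]. *)
have orb_fin x : finite_set [set act s x | s in @transporter R V P Gamma root root].
  have [n ox] := E_connected root x.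
  apply: sub_finite_set (finite_walks P_stochastic pstar_gt0 pstar_le n root).
  move=> _ [s so <-]; rewrite /= -[X in is_walk _ X]so; apply: is_walk_map ox.
  exact: (E_aut _ (valP s)).
(* Failure for some [j] is exponential decay with rate [1 - q], where [q = 1 / (j + 1)]; when
   [d (2k) = 0] the decay follows from monotonicity. *)
have ratio j : exists k, 0 < decr p k.*2 /\ decr p k.*2 - decr p k.*2.+1 <= decr p k.*2 / j.+1%:R.
  apply: contrapT => /forallNP noratio.
  have [q [q0 q1 qE]] : exists q : R, [/\ 0 < q, q <= 1 & j.+1%:R^-1 = q].
    by exists j.+1%:R^-1; rewrite invr_gt0 invf_le1 ?ltr0n ?ler1n.
  rewrite qE in noratio; have r01 : 0 <= 1 - q < 1 by apply/andP; split; lra.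
  have decay k : decr p k.*2.+1 <= (1 - q) * decr p k.*2.
    have := decr_even_ge0 P_stochastic P_symmetric lazyn_diag root k.
    rewrite le_eqVlt => /predU1P[d0|d0].
      have := decr_odd_le P_stochastic P_symmetric lazyn_diag root k.
      by rewrite -d0 mulr0.
    rewrite leNgt; apply/negP => h; apply: (noratio k); split=> //; lra.
  have [theta [kappa [kappa0 antisym theta_le drift]]] :=
    drift_flow P_stochastic P_symmetric lazyn_diag root E_connected pstar_gt0 pstar_le
      V_infinite r01 decay.
  (* Two Haar measures occur: [mu] serves mass transport and [nu] carries the mean. They need not be
     compared, as only locally constant functions are averaged. *)
  have [mu [mu_left mu_right]] := Gamma_unimodular.
  have [nu [_ [m m_mean]]] := Gamma_amenable.
  apply: (amenable_no_drift m_mean (o := root) _ _ _ _ antisym theta_le kappa0 drift).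
  - by move=> F t; exact: (mass_transport Gamma_closed mu_left mu_right trans orb_fin).
  - by move=> x y; exact: lazynC.
  - by move=> g x y; apply: lazyn_aut => //; [exact: act_bij|exact: act_P].
  - by exists 1 => x; exact: has_sum_lazyn.
pose k_ j := projT1 (cid (ratio j)).
have kP j : 0 < decr p (k_ j).*2 /\ decr p (k_ j).*2 - decr p (k_ j).*2.+1 <= decr p (k_ j).*2 / j.+1%:R.
  exact: projT2 (cid (ratio j)).
(* An ultrafilter finer than [\oo] yields the limits for all pairs of points at once, in place of a
   diagonal extraction. *)
have [F [FF F_oo]] := ultraFilterLemma (F := \oo : set_system nat) _.
exact: (exists_harmonic_map P_stochastic P_symmetric lazyn_diag root E_symmetric E_connected
  pstar_gt0 pstar_le P_moment kP FF F_oo).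
Qed.
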